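(* Let $\varphi\colon[0,\frac12]\to(0,+\infty]$ be a continuous (strictly) decreasing function with $\varphi(0)=+\infty$, finite on $(0,\frac12]$, which is regular, i.e. satisfies (Reg1) or (Reg2) of the context. Let $H\colon\mathbb T\to[0,+\infty]$ be a measurable function with $\int_{\mathbb T}H\,dm=+\infty$ and $\varphi(\frac12)\le\inf_{\mathbb T}H$, and suppose that $H$ is subordinated to $\varphi$. Let $\rho$ be a finite positive measure on $\mathbb T$ with $\int_{\mathbb T}e^H\,d\rho<\infty$. Then there exist $c>0$ and $n_0$, not depending on $n$, such that for all $n\ge n_0$ $$|\log e_n(\rho)|\ge c\int_0^{A}\lambda_H(a)\,da,$$ where $A=A(n)$ is the solution of the equation $n\varphi^{-1}(A)=A$ if $\varphi$ satisfies (Reg1), and $A=\sqrt n$ if $\varphi$ satisfies (Reg2).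
   Context: $\mathbb T$ is the unit circle and $m$ is Lebesgue measure on $\mathbb T$ normalized by $m(\mathbb T)=1$. For a finite positive measure $\rho$ on $\mathbb T$, $e_n(\rho)=\min_{q_0,\dots,q_{n-1}\in\mathbb C}\Bigl(\int_{\mathbb T}|q_0+q_1t+\dots+q_{n-1}t^{n-1}+t^n|^2\,d\rho(t)\Bigr)^{1/2}$. Conventions: $|\log 0|=+\infty$, $e^{+\infty}=+\infty$. The distribution function is $\lambda_H(a)=m\{t\in\mathbb T:H(t)>a\}$. Subordination: given $\tau\in[-\frac12,\frac12]$ let $\theta_\tau\in[0,\frac12]$ be the solution of $\varphi(\theta_\tau)=H(e^{2\pi i\tau})$. $H$ is subordinated to $\varphi$ if for every $\tau\in[-\frac12,\frac12]$: $H(e^{2\pi i\theta})\le\varphi(\theta+\theta_\tau-\tau)$ for $\tau-\theta_\tau<\theta\le\tau$, and $H(e^{2\pi i\theta})\le\varphi(\tau+\theta_\tau-\theta)$ for $\tau\le\theta<\tau+\theta_\tau$. Regularity: (Reg1) the function $\theta\mapsto\theta\varphi(\theta)$ does not decrease on $(0,\frac12]$ and there is $c_1>0$ with $\varphi(\theta)\ge c_1\log\frac1\theta$ for $\theta\in(0,\frac12]$; (Reg2) there are $C_2,c_2>0$ with $\varphi(\theta/2)\le C_2\varphi(\theta)$ and $\varphi(\theta)\ge c_2/\theta$ for $\theta\in(0,\frac12]$. *)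

(* Defs.v *)
From HB Require Import structures.
From mathcomp Require Import all_boot all_order all_algebra.
From mathcomp Require Import complex.
From mathcomp Require Import all_classical all_reals all_analysis.
From mathcomp Require Import measurable_realfun.

Set Implicit Arguments.
Unset Strict Implicit.
Unset Printing Implicit Defensive.

Import Order.TTheory GRing.Theory Num.Theory.
Import numFieldNormedType.Exports.

Local Open Scope classical_set_scope.
Local Open Scope ring_scope.

(* [Normc.normc : R[i] -> R] is the real-valued modulus; the generic norm
   [`|z|] of [R[i]] takes its values in [R[i]]. *)
Definition circle (R : realType) : Type := {z : R[i] | Normc.normc z == 1}.

HB.instance Definition _ (R : realType) :=
  SubChoice.copy (circle R) {z : R[i] | Normc.normc z == 1}.

Lemma normc_cos_sin (R : realType) (x : R) :
  Normc.normc (Complex (cos x) (sin x)) == 1.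
Proof. by rewrite /= cos2Dsin2 sqrtr1. Qed.

(* e^{2 pi i th} *)
Definition cexp2pi (R : realType) (th : R) : circle R :=
  exist (fun z : R[i] => Normc.normc z == 1) _ (normc_cos_sin (2 * pi * th)).

HB.instance Definition _ (R : realType) :=
  isPointed.Build (circle R) (cexp2pi 0).

Definition circle_coord (R : realType) (t : circle R) : R * R :=
  (complex.Re (val t), complex.Im (val t)).

(* The Borel sigma-algebra of the circle: the trace of that of the plane. *)
HB.instance Definition _ (R : realType) :=
  Measurable.copy (circle R) (g_sigma_algebra_preimageType (@circle_coord R)).

Lemma measurable_cexp2pi (R : realType) :
  measurable_fun [set: R] (@cexp2pi R).
Proof.
move=> _ _ [B mB <-]; rewrite !setTI.
suff : measurable_fun [set: R] (@circle_coord R \o @cexp2pi R).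
  by move=> /(_ measurableT _ mB); rewrite setTI.
have mlin : measurable_fun [set: R] (fun th : R => 2 * pi * th).
  exact: measurable_funM.
apply/measurable_fun_pairP; split.
- have /continuous_measurable_fun mcos := @continuous_cos R.
  exact: measurableT_comp mcos mlin.
- have /continuous_measurable_fun msin := @continuous_sin R.
  exact: measurableT_comp msin mlin.
Qed.

Section circle_measure.
Context (R : realType).
Local Open Scope ereal_scope.

(* m, normalized by m(T) = 1 *)
Definition circle_measure : set (circle R) -> \bar R :=
  pushforward
    (mrestr lebesgue_measure (measurable_itv `[(- 2^-1)%R : R, 2^-1%R[))
    (@cexp2pi R).

Let circle_measure0 : circle_measure set0 = 0.
Proof. by rewrite /circle_measure /pushforward preimage_set0 measure0. Qed.

Let circle_measure_ge0 A : 0 <= circle_measure A.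
Proof. by rewrite /circle_measure /pushforward measure_ge0. Qed.

Let circle_measure_sigma_additive : semi_sigma_additive circle_measure.
Proof.
by apply: measure_semi_sigma_additive; exact: measurable_cexp2pi.
Qed.

HB.instance Definition _ := isMeasure.Build _ _ _ circle_measure
  circle_measure0 circle_measure_ge0 circle_measure_sigma_additive.

Lemma circle_measure_setT : circle_measure setT = 1.
Proof.
rewrite /circle_measure /pushforward preimage_setT /mrestr setTI.
rewrite lebesgue_measure_itv/= lte_fin ifT; last by rewrite gtrN// invr_gt0.
by rewrite opprK -EFinD -[X in (X + _)%R]div1r -[X in (_ + X)%R]div1r -splitr.
Qed.

HB.instance Definition _ := Measure_isProbability.Build _ _ _
  circle_measure circle_measure_setT.

End circle_measure.
Arguments circle_measure : clear implicits.

Section notions.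
Context (R : realType).
Local Open Scope ereal_scope.
Implicit Types (phi : R -> \bar R) (H : circle R -> \bar R).

(* e_n(rho); by finite-dimensionality the infimum over q is attained. *)
Definition poly_dist (rho : set (circle R) -> \bar R) (n : nat) : \bar R :=
  ereal_inf (range (fun q : 'I_n -> R[i] =>
    (\int[rho]_t
      ((Normc.normc ((\sum_(k < n) q k * val t ^+ k) + val t ^+ n) ^+ 2)%R)%:E)
    `^ 2^-1)).

Definition distr_fun H (a : R) : \bar R :=
  circle_measure R [set t | a%:E < H t].

(* [phi : R -> \bar R] is only meaningful on [0, 1/2]. *)
Definition subordinated H phi : Prop :=
  forall tau : R, (- 2^-1 <= tau <= 2^-1)%R ->
  forall th_tau : R, (0 <= th_tau <= 2^-1)%R ->
    phi th_tau = H (cexp2pi tau) ->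
  (forall th : R, (tau - th_tau < th <= tau)%R ->
     H (cexp2pi th) <= phi (th + th_tau - tau)%R) /\
  (forall th : R, (tau <= th < tau + th_tau)%R ->
     H (cexp2pi th) <= phi (tau + th_tau - th)%R).

Definition reg1 phi : Prop :=
  (forall x y : R, (0 < x)%R -> (x <= y)%R -> (y <= 2^-1)%R ->
     x%:E * phi x <= y%:E * phi y) /\
  (exists2 c1 : R, (0 < c1)%R &
     forall x : R, (0 < x <= 2^-1)%R -> (c1 * ln x^-1)%:E <= phi x).

Definition reg2 phi : Prop :=
  exists C2 c2 : R, [/\ (0 < C2)%R, (0 < c2)%R &
    forall x : R, (0 < x <= 2^-1)%R ->
      phi (x / 2)%R <= C2%:E * phi x /\ (c2 / x)%:E <= phi x].

Definition regular phi : Prop := reg1 phi \/ reg2 phi.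

(* A solves n phi^{-1}(A) = A; here [x] is phi^{-1}(A). *)
Definition solves_level_eq phi (n : nat) (A : R) : Prop :=
  exists x : R, [/\ (0 <= x <= 2^-1)%R, phi x = A%:E & (n%:R * x)%R = A].

End notions.

(* Main.v *)
Require Import Defs.
From HB Require Import structures.
From mathcomp Require Import all_boot all_order all_algebra.
From mathcomp Require Import complex.
From mathcomp Require Import all_classical all_reals all_analysis.
From mathcomp Require Import measurable_realfun.
From mathcomp Require Import ring lra.

Set Implicit Arguments.
Unset Strict Implicit.
Unset Printing Implicit Defensive.

Import Order.TTheory GRing.Theory Num.Theory.
Import numFieldNormedType.Exports.

Local Open Scope classical_set_scope.
Local Open Scope ring_scope.

(** The distance is bounded from above by exhibiting, for every large [n], one
    monic polynomial of degree [n] which is small in [L^2 (rho)]; since [expeR H]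
    is [rho]-integrable, it is enough that the square of its modulus be at most a
    constant times [exp (H - eps * S)] on the circle, where [S] is at least a
    multiple of the integral of the distribution function up to height [A].

    Put [E = min (H, A)]. The ideal candidate is the reversal of [F / F 0], where
    [F = exp G] and the real part of [G] is [eps] times the Poisson integral of
    [E] in a disk of radius [1 + 2 * s] slightly larger than the unit disk. Three
    facts make this work.
    - On the circle of radius [1 + s] the real part of [G] is at most
      [2 * eps * A]. So, by Cauchy's estimate, the Taylor coefficients of [F]
      beyond [n] are negligible as soon as
      [2 * eps * A + ln (1 / s) <= n * s / 2], and [F] can be truncated at degree
      [n] ([truncated_exponential]).
    - On the unit circle [Re G] is at most [E / 2] ([truncation_average_le]).
      Subordination says that [H = phi o g] with [g] a 1-Lipschitz function, and
      [phi] is doubling in both regimes, so at distance at most [g / 2] of a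
      point [H] is at most a multiple of its value there
      ([subordinated_near]). At larger distances [E] is at most [A] and the
      Poisson kernel of scale [s] contributes at most a multiple of [s * A / g];
      this is at most a multiple of [phi g] if [s * A <= K * x * phi x] whenever
      [phi x <= A].
    - [F 0 = exp (eps * S)], where [S] is the mean of [E]; it is the integral of
      the distribution function from [0] to [A] ([int_distr_fun_le]); the mean
      tends to infinity with [A] because [H] is not integrable, which absorbs all
      the multiplicative constants ([bound_of_scale]).
    The conditions on [s] hold with [s = k * phi^{-1} (A)], [k] a large constant,
    in the first regime ([bound_reg1]), and with [s = 6 / sqrt n] in the second
    one ([bound_reg2]).

    Everything is carried out with polynomials. The Poisson integral is an average
    over [M] equidistributed points, with [M] large depending on [n]; this loses
    only the doubling constant, because [E] varies by at most that factor between
    consecutive points. The Herglotz kernel is replaced by its Taylor polynomial of degree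
    [M - 1], and [exp G] by [(1 + G / N) ^ N], whose modulus is at most
    [exp (Re G + |G| ^ 2 / (2 * N))]. Averages over equidistributed points replace
    integrals over circles both in the mean value property of the kernel
    ([sum_herglotz]) and in Cauchy's estimate ([cauchy_estimate]). The tail of the
    Poisson kernel of scale [s] away from its pole is compared with the Poisson
    kernel of a larger scale [d] ([poisson_far_le]), so that the remote part of the
    average is again estimated by the mean value property. *)

(** * The modulus of complex numbers *)

Section modulus.
Context (R : realType).
Implicit Types (z w : R[i]) (x y : R).
Local Notation cabs := (@Normc.normc R).

Lemma cabs_ge0 z : 0 <= cabs z.
Proof. by case: z => a b; exact: sqrtr_ge0. Qed.

Lemma cabsD z w : cabs (z + w) <= cabs z + cabs w.
Proof. exact: le_normcD. Qed.

Lemma cabsN z : cabs (- z) = cabs z.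
Proof. exact: normcN. Qed.

Lemma cabs_sub z w : cabs (z - w) = cabs (w - z).
Proof. by rewrite -cabsN opprB. Qed.

Lemma cabsM z w : cabs (z * w) = cabs z * cabs w.
Proof. exact: Normc.normcM. Qed.

Lemma cabs1 : cabs 1 = 1.
Proof. exact: Normc.normc1. Qed.

Lemma cabs0 : cabs 0 = 0.
Proof. exact: Normc.normc0. Qed.

Lemma cabs_eq0 z : (cabs z == 0) = (z == 0).
Proof.
apply/eqP/eqP => [|->]; last exact: cabs0.
exact: Normc.eq0_normc.
Qed.

Lemma cabsX z n : cabs (z ^+ n) = cabs z ^+ n.
Proof. by elim: n => [|n IH]; rewrite ?expr0 ?cabs1// !exprS cabsM IH. Qed.

Lemma cabsV z : cabs z^-1 = (cabs z)^-1.
Proof. exact: Normc.normcV. Qed.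

Lemma cabs_real x : cabs (x%:C)%C = `|x|.
Proof. by rewrite /= expr0n addr0 sqrtr_sqr. Qed.

Lemma cabs_sum (I : Type) (r : seq I) (P : pred I) (F : I -> R[i]) :
  cabs (\sum_(i <- r | P i) F i) <= \sum_(i <- r | P i) cabs (F i).
Proof.
elim/big_rec2: _ => [|i x z _ xz]; first by rewrite cabs0.
by apply: le_trans (cabsD _ _) _; rewrite lerD2l.
Qed.

Lemma cabs_sqr z : cabs z ^+ 2 = complex.Re z ^+ 2 + complex.Im z ^+ 2.
Proof. by case: z => a b; rewrite /= sqr_sqrtr// addr_ge0// sqr_ge0. Qed.

Lemma Re_sum (I : Type) (r : seq I) (P : pred I) (F : I -> R[i]) :
  complex.Re (\sum_(i <- r | P i) F i) = \sum_(i <- r | P i) complex.Re (F i).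
Proof. by elim/big_rec2: _ => // i x z _ <-; case: (F i) z => a b []. Qed.

Lemma Re_realM x z : complex.Re ((x%:C)%C * z) = x * complex.Re z.
Proof. by case: z => a b /=; rewrite mul0r subr0. Qed.

Lemma normr_Re_le z : `|complex.Re z| <= cabs z.
Proof.
rewrite -(@ler_pXn2r _ 2) ?nnegrE ?cabs_ge0//.
by rewrite real_normK ?num_real// cabs_sqr lerDl sqr_ge0.
Qed.

Lemma cabs_leB z w : cabs z - cabs w <= cabs (z - w).
Proof. by rewrite lerBlDr; apply: le_trans (cabsD _ _); rewrite subrK. Qed.

Lemma cabs_sqr1D z : cabs (1 + z) ^+ 2 = 1 + 2 * complex.Re z + cabs z ^+ 2.
Proof. by rewrite !cabs_sqr; case: z => a b /=; ring. Qed.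

(** The power [(1 + z / N) ^ N] plays the role of the exponential of [z]: up to a
    constant factor its modulus is at most [exp (Re z)]. *)
Lemma cabs_expD1_le z (N : nat) : cabs z ^+ 2 <= N%:R -> (0 < N)%N ->
  cabs ((1 + z / N%:R) ^+ N) ^+ 2 <= expR (2 * complex.Re z + 1).
Proof.
move=> zN N0.
have N0' : 0 < N%:R :> R by rewrite ltr0n.
have Ninv : (N%:R : R[i])^-1 = ((N%:R^-1)%:C)%C by rewrite fmorphV rmorph_nat.
rewrite cabsX exprAC cabs_sqr1D Ninv [z * _]mulrC Re_realM cabsM cabs_real.
rewrite ger0_norm ?invr_ge0 ?ler0n//.
have -> : 1 + 2 * (N%:R^-1 * complex.Re z) + (N%:R^-1 * cabs z) ^+ 2 =
   1 + (2 * complex.Re z + cabs z ^+ 2 / N%:R) / N%:R.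
  by field; rewrite gt_eqF.
have -> : expR (2 * complex.Re z + 1) =
    expR ((2 * complex.Re z + 1) / N%:R) ^+ N.
  by rewrite -expRM_natl [N%:R * _]mulrC divfK// gt_eqF.
apply: lerXn2r; rewrite ?nnegrE ?expR_ge0//.
  rewrite (_ : 1 + _ = cabs (1 + z / N%:R) ^+ 2) ?exprn_ge0 ?cabs_ge0//.
  rewrite cabs_sqr1D Ninv [z * _]mulrC Re_realM cabsM cabs_real.
  by rewrite ger0_norm ?invr_ge0 ?ler0n//; field; rewrite gt_eqF.
apply: le_trans (expR_ge1Dx _) _; rewrite ler_expR ler_pM2r ?invr_gt0//.
by rewrite lerD2l ler_pdivrMr// mul1r.
Qed.

Lemma expR_half_le x (N : nat) : (0 < N)%N -> 0 <= x <= N%:R ->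
  expR (x / 2) <= (1 + x / N%:R) ^+ N.
Proof.
move=> N0 /andP[x0 xN].
have N0' : 0 < N%:R :> R by rewrite ltr0n.
set y := x / N%:R.
have y0 : 0 <= y by rewrite divr_ge0// ltW.
have y1 : y <= 1 by rewrite ler_pdivrMr// mul1r.
have -> : expR (x / 2) = expR (y / 2) ^+ N.
  rewrite -expRM_natl /y; congr expR; field.
  by rewrite gt_eqF.
apply: lerXn2r; rewrite ?nnegrE ?expR_ge0// ?addr_ge0//.
have h := expR_ge1Dx (- (y / 2)).
rewrite expRN in h.
have e0 := expR_gt0 (y / 2).
have : (1 - y / 2) * expR (y / 2) <= 1.
  by rewrite -ler_pdivlMr// mul1r.
nra.
Qed.

End modulus.

(** * Points of the circle and roots of unity *)

Section circle_points.
Context (R : realType).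
Implicit Types (x y : R).
Local Notation cabs := (@Normc.normc R).
Local Notation e x := (val (cexp2pi x) : R[i]).

Lemma cexp2piD x y : e (x + y) = e x * e y.
Proof.
rewrite /= mulrDr cosD sinD; congr Complex.
by rewrite addrC mulrC [X in _ + X]mulrC addrC; ring.
Qed.

Lemma cexp2pi0 : e 0 = 1.
Proof. by rewrite /= mulr0 cos0 sin0. Qed.

Lemma cexp2pi1 : e 1 = 1.
Proof. by rewrite /= mulr1 mulrC mulr_natr cos2pi sin2pi. Qed.

Lemma cabs_circle (t : circle R) : cabs (val t) = 1.
Proof. by case: t => z /= /eqP. Qed.

Lemma cexp2piN x : e (- x) = (e x)^-1.
Proof.
have ex0 : e x != 0 by rewrite -cabs_eq0 cabs_circle oner_eq0.
by apply: (mulfI ex0); rewrite divff// -cexp2piD subrr cexp2pi0.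
Qed.

Lemma cexp2piMn x n : e (n%:R * x) = e x ^+ n.
Proof.
elim: n => [|n IH]; first by rewrite mul0r expr0 cexp2pi0.
by rewrite -natr1 mulrDl mul1r cexp2piD IH exprSr.
Qed.

(** By the mean value theorem on [[0, x / 2]] and the double angle formulas,
    [sin x >= x * cos (x / 2) ^ 2], and [cos (x / 2) ^ 2 >= 1 / 2]. *)
Lemma sin_ge_half x : 0 <= x <= pi / 2 -> x / 2 <= sin x.
Proof.
move=> /andP[x0 x2].
have [->|xn0] := eqVneq x 0; first by rewrite mul0r sin0.
have xp : 0 < x by rewrite lt_neqAle eq_sym xn0.
have cosx0 : 0 <= cos x.
  by apply: cos_ge0_pihalf; rewrite x2 andbT; have := pi_ge0 R; lra.
have [c] := @MVT R sin cos 0 (x / 2) ltac:(lra)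
  (fun y _ => is_derive_sin y) (continuous_subspaceT (@continuous_sin R)).
rewrite in_itv/= => /andP[c0 cx]; rewrite sin0 !subr0 => sx.
have cle : cos (x / 2) <= cos c.
  by apply: ltW; rewrite ltr_cos// in_itv/=; have := pi_ge0 R; lra.
have cx2 : cos x = cos (x / 2) ^+ 2 *+ 2 - 1.
  by rewrite -cos_mulr2n; congr cos; rewrite -mulr_natr; field.
have sx2 : sin x = (cos (x / 2) * sin (x / 2)) *+ 2.
  by rewrite -sin_mulr2n; congr sin; rewrite -mulr_natr; field.
have ch0 : 0 <= cos (x / 2).
  by apply: cos_ge0_pihalf; have := pi_ge0 R; lra.
rewrite sx2 sx -[X in _ <= X]mulr_natr; rewrite -[X in X - 1]mulr_natr in cx2.
have h : cos (x / 2) ^+ 2 <= cos (x / 2) * cos c by rewrite expr2 ler_wpM2l.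
have h2 : 2^-1 <= cos (x / 2) * cos c by lra.
have -> : cos (x / 2) * (cos c * (x / 2)) * 2 =
  x * (cos (x / 2) * cos c) by field.
exact: ler_wpM2l.
Qed.

(** Chords of the circle are at least twice the corresponding arcs, in turns. *)
Lemma chord_ge x : `|x| <= 2^-1 -> 2 * `|x| <= cabs (1 - e x).
Proof.
move=> x2; have p2 := pi_ge2 R.
have x0 := normr_ge0 x.
rewrite -(@ler_pXn2r _ 2) ?nnegrE ?cabs_ge0 ?mulr_ge0//.
have -> : cabs (1 - e x) ^+ 2 = (2 * sin (pi * `|x|)) ^+ 2.
  rewrite cabs_sqr.
  have -> : (2 * sin (pi * `|x|)) ^+ 2 = 2 * (1 - cos (2 * pi * x)).
    have -> : cos (2 * pi * x) = cos ((pi * `|x|) *+ 2).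
      rewrite -(cos_norm (2 * pi * x)) normrM ger0_norm; last by nra.
      by congr cos; rewrite -mulr_natr; ring.
    rewrite cos_mulr2n exprMn sin2cos2; ring.
  rewrite /=; set c := cos _; set d := sin _.
  transitivity (1 - 2 * c + (c ^+ 2 + d ^+ 2)); first by ring.
  by rewrite /c /d cos2Dsin2; ring.
rewrite ler_pXn2r ?nnegrE ?mulr_ge0//; last first.
  by apply: sin_ge0_pi; nra.
rewrite ler_wpM2l//; apply: le_trans (sin_ge_half _); first by nra.
by apply/andP; split; nra.
Qed.

Lemma sum_unity_root (x : R[i]) (W : nat) : x ^+ W = 1 -> x != 1 ->
  \sum_(j < W) x ^+ j = 0.
Proof.
move=> xW x1; have := subrX1 x W; rewrite xW subrr => /esym/eqP.
by rewrite mulf_eq0 subr_eq0 (negbTE x1) => /eqP.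
Qed.

Lemma cexp2pi_prim_root (W : nat) : (0 < W)%N ->
  W.-primitive_root (e W%:R^-1).
Proof.
move=> W0; have W0' : 0 < W%:R :> R by rewrite ltr0n.
apply/andP; split => //; apply/forallP => i; apply/eqP.
rewrite unity_rootE -cexp2piMn.
have [iW|iW] := eqVneq i.+1 W.
  have -> : i.+1%:R / W%:R = 1 :> R by rewrite iW divff// gt_eqF.
  by rewrite cexp2pi1 eqxx.
have iltW : (i.+1 < W)%N by rewrite ltn_neqAle iW/=.
have lt1 : i.+1%:R / W%:R < 1 :> R by rewrite ltr_pdivrMr// mul1r ltr_nat.
have gt0 : 0 < i.+1%:R / W%:R :> R by rewrite divr_gt0.
move: lt1 gt0; set y := i.+1%:R / W%:R => y1 y0.
apply/negbTE/negP => /eqP ey.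
have [y2|y2] := leP y 2^-1.
  have := @chord_ge y; rewrite ey subrr cabs0 gtr0_norm// => /(_ y2).
  lra.
have := @chord_ge (y - 1).
rewrite cexp2piD ey mul1r cexp2piN cexp2pi1 invr1 subrr cabs0 ltr0_norm; lra.
Qed.

(** Cauchy's estimate for the Taylor coefficients of a polynomial; the contour
    integral is a sum over roots of unity. *)
Lemma cauchy_estimate (p : {poly R[i]}) (r B : R) : 0 < r ->
  (forall z, cabs z = r -> cabs p.[z] <= B) ->
  forall k, cabs p`_k * r ^+ k <= B.
Proof.
move=> r0 pB k.
pose W := maxn (size p) k.+1.
have W0 : (0 < W)%N by rewrite /W leq_max orbT.
have kW : (k < W)%N by rewrite /W leq_max leqnn orbT.
have W0' : 0 < W%:R :> R by rewrite ltr0n.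
have om := cexp2pi_prim_root W0; move: om; set w := e _ => om.
have cw : cabs w = 1 by rewrite cabs_circle.
have w0 : w != 0 by rewrite -cabs_eq0 cw oner_eq0.
have pE z : p.[z] = \sum_(l < W) p`_l * z ^+ l.
  by apply: horner_coef_wide; rewrite /W leq_maxl.
have key : \sum_(j < W) p.[(r%:C)%C * w ^+ j] * (w ^+ j) ^- k =
    W%:R * (p`_k * (r%:C)%C ^+ k).
  under eq_bigr => j _ do rewrite pE mulr_suml.
  rewrite exchange_big /= (bigD1 (Ordinal kW)) //= [X in _ + X]big1 ?addr0.
    rewrite (eq_bigr (fun=> p`_k * (r%:C)%C ^+ k)).
      by rewrite sumr_const card_ord mulr_natl.
    by move=> j _; rewrite exprMn !mulrA mulfK// !expf_neq0.
  move=> l lk; rewrite (eq_bigr (fun j : 'I_W =>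
     p`_l * (r%:C)%C ^+ l * (w ^+ l / w ^+ k) ^+ j)); last first.
    move=> j _; rewrite exprMn -!mulrA; congr (_ * (_ * _)).
    by rewrite expr_div_n -!exprM ![(_ * j)%N]mulnC.
  rewrite -mulr_sumr sum_unity_root ?mulr0//.
    by rewrite expr_div_n -!exprM ![(_ * W)%N]mulnC !exprM (prim_expr_order om)
      !expr1n divr1.
  apply/negP => /eqP /(congr1 (fun z => z * w ^+ k)).
  rewrite divfK ?expf_neq0// mul1r => /eqP.
  rewrite (eq_prim_root_expr om) !modn_small//.
  by apply/negP; move: lk; apply: contra => /eqP lk; apply/eqP/val_inj.
have : cabs (W%:R * (p`_k * (r%:C)%C ^+ k)) <= W%:R * B.
  rewrite -key; apply: le_trans (cabs_sum _ _ _) _.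
  rewrite -[X in X%:R](card_ord W) mulr_natl -sumr_const; apply: ler_sum => j _.
  rewrite cabsM cabsV !cabsX cw !expr1n invr1 mulr1; apply: pB.
  by rewrite cabsM cabs_real cabsX cw expr1n mulr1 gtr0_norm.
have -> : (W%:R : R[i]) = ((W%:R)%:C)%C by rewrite rmorph_nat.
rewrite !cabsM !cabsX !cabs_real (gtr0_norm W0') (gtr0_norm r0).
by rewrite ler_pM2l.
Qed.

End circle_points.

(** * Truncation of the exponential of a polynomial *)

Section truncated_exponential.
Context (R : realType).
Local Notation cabs := (@Normc.normc R).

Lemma poly_bounded (G : {poly R[i]}) :
  exists2 L : R, 0 <= L & forall z, cabs z <= 2 -> cabs G.[z] <= L.
Proof.
exists (\sum_(k < size G) cabs G`_k * 2 ^+ k).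
  by apply: sumr_ge0 => k _; rewrite mulr_ge0 ?cabs_ge0// exprn_ge0.
move=> z z2; rewrite horner_coef; apply: le_trans (cabs_sum _ _ _) _.
apply: ler_sum => k _; rewrite cabsM cabsX ler_wpM2l ?cabs_ge0//.
by rewrite lerXn2r ?nnegrE ?cabs_ge0.
Qed.

Lemma geometric_tail_le (s : R) (n m : nat) : 0 < s ->
  \sum_(n.+1 <= k < m) (1 + s) ^- k <= ((1 + s) ^+ n * s)^-1.
Proof.
move=> s0; have s1 : 0 < 1 + s by rewrite addr_gt0.
have [mn|nm] := leqP m n.+1.
  by rewrite big_geq// invr_ge0 mulr_ge0 ?exprn_ge0// ltW.
suff : \sum_(n.+1 <= k < m) (1 + s) ^- k <=
    ((1 + s) ^+ n * s)^-1 - ((1 + s) ^+ m.-1 * s)^-1.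
  move=> /le_trans; apply; rewrite gerBl invr_ge0 mulr_ge0 ?exprn_ge0//; exact: ltW.
elim: m nm => // m IH; rewrite ltnS => nm.
have [->|mn] := eqVneq m n.+1.
  rewrite big_nat1 /= exprS le_eqVlt; apply/orP; left; apply/eqP; field.
  by rewrite !gt_eqF// ?exprn_gt0.
have {}nm : (n.+1 < m)%N by rewrite ltn_neqAle eq_sym mn.
rewrite big_nat_recr//=; last exact: ltnW.
apply: le_trans (lerD (IH nm) (lexx _)) _.
rewrite -addrA lerD2l; case: m nm {IH mn} => // m _ /=.
rewrite exprS le_eqVlt; apply/orP; left; apply/eqP; field.
by rewrite !gt_eqF// ?exprn_gt0.
Qed.

Lemma expR_half_le1D (s : R) : 0 <= s <= 1 -> expR (s / 2) <= 1 + s.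
Proof.
by move=> s01; have := @expR_half_le R s 1 isT s01; rewrite divr1 expr1.
Qed.

(** The exponential of [G], truncated at degree [n] and normalized at [0], where
    [G] takes the value [x], is controlled on the unit circle by the exponential
    itself, provided that the real part of [G] is small compared to [n * s] on
    the circle of radius [1 + s]. *)
Lemma truncated_exponential (G : {poly R[i]}) (n : nat) (s b x : R) :
  0 < s <= 1 -> 0 <= x -> G.[0] = (x%:C)%C ->
  (forall z, cabs z = 1 + s -> complex.Re G.[z] <= b) ->
  b + ln s^-1 <= n%:R * (s / 2) ->
  exists p : {poly R[i]}, [/\ (size p <= n.+1)%N, p.[0] = 1 &
    forall z, cabs z = 1 ->
      cabs p.[z] ^+ 2 <=
        2 * (expR (2 * complex.Re G.[z] + 1) + expR 1) * expR (- x)].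
Proof.
move=> /andP[s0 s1] x0 G0 Gb bns.
have [L L0 GL] := poly_bounded G.
(* [N] bounds both [G 0] and the square of the modulus of [G] on the disk of
   radius [2], as both estimates of [(1 + G / N) ^ N] require. *)
have [N NL] : exists2 N : nat, (0 < N)%N & L + L ^+ 2 <= N%:R.
  have := archi_boundP (addr_ge0 L0 (sqr_ge0 L)).
  set N := Num.bound _ => hN; exists N; last exact: ltW.
  rewrite lt0n; apply/negP => /eqP N0; move: hN; rewrite N0 ltNge.
  by rewrite addr_ge0// sqr_ge0.
move=> hN.
have L2N : L ^+ 2 <= N%:R by lra.
have LN : L <= N%:R by have := sqr_ge0 L; lra.
have N0' : 0 < N%:R :> R by rewrite ltr0n.
pose Q := (1 + (N%:R)^-1 *: G) ^+ N.
have QE z : Q.[z] = (1 + G.[z] / N%:R) ^+ N.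
  by rewrite /Q horner_exp !hornerE [_^-1 * _]mulrC.
have Qle z : cabs z <= 2 -> cabs Q.[z] ^+ 2 <= expR (2 * complex.Re G.[z] + 1).
  move=> z2; rewrite QE; apply: cabs_expD1_le => //.
  apply: le_trans L2N; rewrite ler_pXn2r ?nnegrE ?cabs_ge0//; exact: GL.
have Qr z : cabs z = 1 + s -> cabs Q.[z] <= expR (b + 2^-1).
  move=> zs; rewrite -(@ler_pXn2r _ 2) ?nnegrE ?cabs_ge0 ?expR_ge0//.
  apply: le_trans (Qle _ _) _; first by rewrite zs; lra.
  rewrite -expRM_natl ler_expR; have := Gb z zs; lra.
have Q0E : Q.[0] = (((1 + x / N%:R) ^+ N)%:C)%C.
  rewrite QE G0 rmorphXn rmorphD rmorph1 rmorphM; congr ((1 + _ * _) ^+ _).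
  by rewrite fmorphV rmorph_nat.
have xN : x <= N%:R.
  apply: le_trans LN; have := GL 0; rewrite G0 cabs0 cabs_real ger0_norm//.
  by apply.
have Q0ge : expR x <= cabs Q.[0] ^+ 2.
  rewrite Q0E cabs_real ger0_norm; last first.
    by rewrite exprn_ge0// addr_ge0// divr_ge0// ltW.
  have -> : expR x = expR (x / 2) ^+ 2.
    by rewrite -expRM_natl; congr expR; field.
  rewrite lerXn2r ?nnegrE ?expR_ge0//.
    by rewrite exprn_ge0// addr_ge0// divr_ge0// ltW.
  by apply: expR_half_le => //; rewrite x0.
have Q00 : Q.[0] != 0.
  rewrite -cabs_eq0; apply/negP => /eqP h; move: Q0ge.
  by rewrite h expr0n leNgt expR_gt0.
(* Summed over [k > n], these bounds give at most
   [exp (b + 1 / 2) / ((1 + s) ^ n * s)], and [(1 + s) ^ n >= exp (n * s / 2)]. *)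
have coefQ k : cabs Q`_k <= expR (b + 2^-1) * (1 + s) ^- k.
  have s1' : 0 < 1 + s by lra.
  rewrite ler_pdivlMr ?exprn_gt0//; exact: cauchy_estimate.
pose T := take_poly n.+1 Q.
have tail z : cabs z = 1 -> cabs (T.[z] - Q.[z]) <= expR 2^-1.
  move=> z1; rewrite cabs_sub.
  have QTE : Q.[z] - T.[z] = \sum_(n.+1 <= k < maxn (size Q) n.+1) Q`_k * z ^+ k.
    rewrite (@horner_coef_wide _ (maxn (size Q) n.+1) Q) ?leq_maxl//.
    rewrite (@horner_coef_wide _ n.+1 T) ?size_take_poly//.
    rewrite -(big_mkord xpredT (fun k => Q`_k * z ^+ k)).
    rewrite (@big_cat_nat _ _ _ n.+1) ?leq_maxr//= addrC big_mkord.
    rewrite -[RHS]addr0 -addrA; congr (_ + _); apply/eqP; rewrite subr_eq0.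
    by apply/eqP/eq_bigr => k _; rewrite coef_take_poly ltn_ord.
  rewrite QTE; apply: le_trans (cabs_sum _ _ _) _.
  apply: (@le_trans _ _ (\sum_(n.+1 <= k < maxn (size Q) n.+1)
      expR (b + 2^-1) * (1 + s) ^- k)).
    by apply: ler_sum => k _; rewrite cabsM cabsX z1 expr1n mulr1.
  rewrite -mulr_sumr.
  apply: (@le_trans _ _ (expR (b + 2^-1) * ((1 + s) ^+ n * s)^-1)).
    by rewrite ler_wpM2l ?expR_ge0// geometric_tail_le.
  have ns : expR (n%:R * (s / 2)) <= (1 + s) ^+ n.
    rewrite expRM_natl lerXn2r ?nnegrE ?expR_ge0//; first by lra.
    by apply: expR_half_le1D; rewrite s1 ltW.
  have s1n : 0 < (1 + s) ^+ n by rewrite exprn_gt0//; lra.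
  rewrite ler_pdivrMr ?mulr_gt0// addrC expRD ler_pM2l ?expR_gt0//.
  rewrite -ler_pdivrMr// -{1}(@lnK _ s^-1) ?posrE ?invr_gt0// -expRD.
  by apply: le_trans ns; rewrite ler_expR.
exists (Q.[0]^-1 *: T); split.
- by apply: leq_trans (size_scale_leq _ _) _; exact: size_take_poly.
- by rewrite hornerZ [T.[0]]horner_coef0 coef_take_poly /= -horner_coef0 mulVf.
move=> z z1; rewrite hornerZ cabsM cabsV exprMn mulrC exprVn expRN.
have q0 : 0 < cabs Q.[0] ^+ 2 by apply: lt_le_trans Q0ge; rewrite expR_gt0.
apply: ler_pM; rewrite ?exprn_ge0 ?cabs_ge0 ?invr_ge0 ?(ltW q0)//; last first.
  by rewrite lef_pV2 ?posrE ?expR_gt0.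
have Tz : cabs T.[z] <= cabs Q.[z] + cabs (T.[z] - Q.[z]).
  by apply: le_trans (cabsD _ _); rewrite addrC subrK.
have := tail z z1; have := Qle z; rewrite z1 => /(_ (ler1n _ _)).
have := cabs_ge0 T.[z].
have -> : expR 1 = expR 2^-1 ^+ 2 :> R.
  by rewrite -expRM_natl; congr expR; field.
move: Tz (cabs_ge0 Q.[z]) (cabs_ge0 (T.[z] - Q.[z])).
set q := cabs Q.[z]; set t := cabs T.[z]; set d := cabs _.
set E1 := expR (_ + 1); set E2 := expR _ => h1 q0' d0 t0 h2 h3.
have h4 : d ^+ 2 <= E2 ^+ 2 by rewrite lerXn2r// nnegrE// ltW// expR_gt0.
have h5 : t ^+ 2 <= (q + d) ^+ 2 by rewrite lerXn2r// nnegrE// addr_ge0.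
have := sqr_ge0 (q - d); nra.
Qed.

(** Reversing the coefficients turns a polynomial with constant term [1] into
    a monic one with the same modulus on the unit circle. *)
Lemma monic_reversal (p : {poly R[i]}) (n : nat) : (size p <= n.+1)%N ->
  p.[0] = 1 -> exists q : 'I_n -> R[i], forall t, cabs t = 1 ->
  cabs (\sum_(k < n) q k * t ^+ k + t ^+ n) = cabs p.[t^-1].
Proof.
move=> sp p0; exists (fun k => p`_(n - k)) => t t1.
have t0 : t != 0 by rewrite -cabs_eq0 t1 oner_eq0.
suff -> : \sum_(k < n) p`_(n - k) * t ^+ k + t ^+ n = t ^+ n * p.[t^-1].
  by rewrite cabsM cabsX t1 expr1n mul1r.
have -> : t ^+ n = p`_(n - n) * t ^+ n by rewrite subnn -horner_coef0 p0 mul1r.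
rewrite -(big_ord_recr _ (fun k => p`_(n - k) * t ^+ k)) /= subnn -horner_coef0 p0 mul1r.
rewrite (horner_coef_wide _ sp) mulr_sumr (reindex_inj rev_ord_inj) /=.
apply: eq_bigr => k _; rewrite subSS.
have kn : (k <= n)%N by rewrite -ltnS.
rewrite subKn// mulrCA; congr (_ * _).
by rewrite exprVn expfB_cond// (negbTE t0) add0n.
Qed.

End truncated_exponential.

(** * The Herglotz kernel *)

Section herglotz_kernel.
Context (R : realType).
Implicit Types (z w : R[i]).
Local Notation cabs := (@Normc.normc R).

(** The Taylor polynomial of degree less than [M] of the Herglotz kernel
    [(1 + w) / (1 - w)], whose real part is the Poisson kernel. *)
Definition herglotz (M : nat) : {poly R[i]} := 1 + 2 *: \sum_(1 <= k < M) 'X^k.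

Lemma hornerE_herglotz M w :
  (herglotz M).[w] = 1 + 2 * \sum_(1 <= k < M) w ^+ k.
Proof.
rewrite /herglotz !hornerE horner_sum; congr (1 + 2 * _).
by apply: eq_bigr => k _; rewrite hornerXn.
Qed.

Lemma herglotz_closed M w : (0 < M)%N ->
  (1 - w) * (herglotz M).[w] = 1 + w - 2 * w ^+ M.
Proof.
move=> M0; rewrite hornerE_herglotz.
suff h : (1 - w) * \sum_(1 <= k < M) w ^+ k = w - w ^+ M by rewrite mulrDr mulr1 mulrCA h; ring.
elim: M M0 => // M IH _; have [->|M0] := posnP M.
  by rewrite big_geq// mulr0 expr1 subrr.
by rewrite big_nat_recr//= mulrDr IH// exprS; ring.
Qed.

(** The real part of the truncated kernel is the Poisson kernel, up to the
    truncation error on the disk of radius [d]. *)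
Lemma herglotz_poisson M w (d eta : R) : (0 < M)%N -> cabs w <= d -> d < 1 ->
  2 * d ^+ M / (1 - d) <= eta ->
  `|complex.Re (herglotz M).[w] - (1 - cabs w ^+ 2) / cabs (1 - w) ^+ 2| <= eta.
Proof.
move=> M0 wd d1 deta.
have c1w : 1 - d <= cabs (1 - w).
  by apply: le_trans (cabs_leB _ _); rewrite cabs1 lerD2l lerN2.
have c1w0 : 0 < cabs (1 - w) by apply: lt_le_trans c1w; rewrite subr_gt0.
have w1 : 1 - w != 0 by rewrite -cabs_eq0 gt_eqF.
have hE : (herglotz M).[w] = (1 + w) / (1 - w) - 2 * w ^+ M / (1 - w).
  by apply: (mulfI w1); rewrite herglotz_closed//; field.
have pE : complex.Re ((1 + w) / (1 - w)) =
    (1 - cabs w ^+ 2) / cabs (1 - w) ^+ 2.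
  have : cabs (1 - w) ^+ 2 != 0 by rewrite gt_eqF// exprn_gt0.
  rewrite !cabs_sqr; case: w {wd c1w c1w0 w1 hE} => a b /= h.
  by rewrite sub0r in h; field.
rewrite -pE hE -normrN opprB.
have -> : complex.Re ((1 + w) / (1 - w)) -
   complex.Re ((1 + w) / (1 - w) - 2 * w ^+ M / (1 - w)) =
   complex.Re (2 * w ^+ M / (1 - w)).
  by case: (_ / _) => a b; case: (_ / _) => c e /=; ring.
apply: le_trans (normr_Re_le _) _; apply: le_trans deta.
rewrite !cabsM cabsV cabsX.
have -> : cabs 2 = 2.
  by rewrite -[2]/(2%:R) -(rmorph_nat (real_complex R) 2) cabs_real ger0_norm.
apply: ler_pM; rewrite ?mulr_ge0 ?invr_ge0 ?exprn_ge0 ?cabs_ge0//.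
  by rewrite ler_wpM2l// lerXn2r ?nnegrE ?cabs_ge0//; apply: le_trans wd; exact: cabs_ge0.
by rewrite lef_pV2// posrE subr_gt0.
Qed.

Lemma herglotz_error_small (d eta : R) : 0 <= d < 1 -> 0 < eta ->
  exists M0 : nat, forall M, (M0 <= M)%N -> 2 * d ^+ M / (1 - d) <= eta.
Proof.
move=> /andP[d0 d1] eta0.
have d1' : 0 < 1 - d by rewrite subr_gt0.
have : (fun M => d ^+ M) @ \oo --> (0 : R).
  by apply: cvg_expr; rewrite ger0_norm.
move=> /cvgrPdist_le /(_ (eta * (1 - d) / 2)).
rewrite divr_gt0 ?mulr_gt0// => /(_ isT) [M0 _ M0P].
exists M0 => M /M0P /=; rewrite sub0r normrN ger0_norm ?exprn_ge0//.
by rewrite ler_pdivrMr//; lra.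
Qed.

Lemma herglotz_error_le (d d' : R) M : 0 < d -> d <= d' ->
  2 * (1 + d')^-1 ^+ M / (1 - (1 + d')^-1) <=
  2 * (1 + d)^-1 ^+ M / (1 - (1 + d)^-1).
Proof.
move=> d0 dd'; have d0' : 0 < d' by lra.
have i0 (x : R) : 0 < x -> 0 <= (1 + x)^-1 by move=> x0; rewrite invr_ge0; lra.
have i1 (x : R) : 0 < x -> 0 < 1 - (1 + x)^-1.
  by move=> x0; rewrite subr_gt0 invf_lt1; lra.
have le_i : (1 + d')^-1 <= (1 + d)^-1 by rewrite lef_pV2 ?posrE; lra.
apply: ler_pM.
- by rewrite mulr_ge0// exprn_ge0// i0.
- by rewrite invr_ge0; apply/ltW/i1.
- by rewrite ler_wpM2l// lerXn2r ?nnegrE ?i0.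
by rewrite lef_pV2 ?posrE ?i1// lerD2l lerN2.
Qed.

(** [M] points of the circle, such as the rotated [M]-th roots of unity, over
    which the averages of polynomials of degree less than [M] are exact. *)
Definition equidistributed (M : nat) (t : 'I_M -> R[i]) : Prop :=
  (forall j, cabs (t j) = 1) /\
  (forall k, (0 < k < M)%N -> \sum_j t j ^+ k = 0).

Lemma equidistributed_circle (M : nat) (x : R) : (0 < M)%N ->
  equidistributed (fun j : 'I_M => val (cexp2pi (j%:R / M%:R + x))).
Proof.
move=> M0; split=> [j|k /andP[k0 kM]]; first exact: cabs_circle.
have om := cexp2pi_prim_root R M0.
rewrite (eq_bigr (fun j : 'I_M => val (cexp2pi x) ^+ k *
   (val (cexp2pi (M%:R)^-1 : circle R) ^+ k) ^+ j)); last first.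
  move=> j _; rewrite cexp2piD cexp2piMn exprMn mulrC; congr (_ * _).
  by rewrite -!exprM mulnC.
rewrite -mulr_sumr sum_unity_root ?mulr0//.
  by rewrite -exprM mulnC exprM (prim_expr_order om) expr1n.
rewrite -(expr0 (val (cexp2pi (M%:R)^-1))) (eq_prim_root_expr om).
by rewrite !modn_small// -lt0n.
Qed.

Lemma sum_herglotz (M : nat) (t : 'I_M -> R[i]) w :
  equidistributed t -> \sum_j (herglotz M).[w * t j] = M%:R.
Proof.
move=> [_ t0]; under eq_bigr => j _ do rewrite hornerE_herglotz.
rewrite big_split/= sumr_const card_ord -mulr_sumr exchange_big/=.
rewrite big_nat big1 ?mulr0 ?addr0// => k kM.
under eq_bigr => j _ do rewrite exprMn.
by rewrite -mulr_sumr t0// mulr0.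
Qed.

Lemma sum_Re_herglotz (M : nat) (t : 'I_M -> R[i]) w :
  equidistributed t -> \sum_j complex.Re (herglotz M).[w * t j] = M%:R.
Proof.
move=> /(sum_herglotz w) h; rewrite -Re_sum h.
by rewrite -(rmorph_nat (real_complex R)).
Qed.

End herglotz_kernel.

(** * Averages of the Poisson kernel over equidistributed points *)

Section herglotz_average.
Context (R : realType).
Implicit Types (z w v : R[i]).
Local Notation cabs := (@Normc.normc R).

Lemma Re_herglotz_ge M w (d eta : R) : (0 < M)%N -> cabs w <= d -> d < 1 ->
  2 * d ^+ M / (1 - d) <= eta -> 0 <= complex.Re (herglotz R M).[w] + eta.
Proof.
move=> M0 wd d1 deta; have := herglotz_poisson M0 wd d1 deta.
rewrite ler_norml => /andP[h _].
suff : 0 <= (1 - cabs w ^+ 2) / cabs (1 - w) ^+ 2 by lra.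
rewrite divr_ge0 ?exprn_ge0 ?cabs_ge0// subr_ge0 expr_le1// ?cabs_ge0//.
by apply: le_trans wd _; exact: ltW.
Qed.

(** Weighted averages of the kernel are at most the maximum of the weight, up
    to the truncation error. *)
Lemma herglotz_average_le_max M (t : 'I_M -> R[i]) (h : 'I_M -> R) w
    (A d eta : R) :
  (0 < M)%N -> equidistributed t -> (forall j, 0 <= h j <= A) ->
  cabs w <= d -> d < 1 -> 2 * d ^+ M / (1 - d) <= eta -> 0 <= eta ->
  \sum_j h j * complex.Re (herglotz R M).[w * t j] <= M%:R * (A * (1 + eta)).
Proof.
move=> M0 tE hA wd d1 deta eta0.
apply: (@le_trans _ _
    (\sum_j A * (complex.Re (herglotz R M).[w * t j] + eta))).
  apply: ler_sum => j _; have /andP[h0 h1] := hA j.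
  have K0 : 0 <= complex.Re (herglotz R M).[w * t j] + eta.
    apply: Re_herglotz_ge deta => //.
    by rewrite cabsM tE.1 mulr1.
  by apply: (@le_trans _ _ (h j * (complex.Re (herglotz R M).[w * t j] + eta)));
    rewrite ?ler_wpM2l ?ler_wpM2r// lerDl.
rewrite -mulr_sumr big_split/= sum_Re_herglotz// sumr_const card_ord.
rewrite -mulr_natr; nra.
Qed.

(** The Poisson kernel of scale [s], away from its singularity, is at most a
    multiple [s / d] of the one of scale [d]. *)
Lemma poisson_far_le v (s d : R) : cabs v = 1 -> 0 < s <= 1 -> 0 < d ->
  d <= cabs (1 - v) ->
  (1 - cabs (v / ((1 + 2 * s)%:C)%C) ^+ 2) /
      cabs (1 - v / ((1 + 2 * s)%:C)%C) ^+ 2 <=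
  16 * (s / d) * ((1 - cabs (v / ((1 + d)%:C)%C) ^+ 2) /
      cabs (1 - v / ((1 + d)%:C)%C) ^+ 2).
Proof.
move=> v1 /andP[s0 s1] d0 dv.
have P (x : R) : 0 < x -> (1 - cabs (v / ((1 + x)%:C)%C) ^+ 2) /
      cabs (1 - v / ((1 + x)%:C)%C) ^+ 2 =
    (2 * x + x ^+ 2) / cabs (((1 + x)%:C)%C - v) ^+ 2.
  move=> x0; have x1 : 0 < 1 + x by lra.
  have cx : cabs ((1 + x)%:C)%C = 1 + x by rewrite cabs_real gtr0_norm.
  have x1' : ((1 + x)%:C)%C != 0 by rewrite -cabs_eq0 cx gt_eqF.
  have -> : 1 - v / ((1 + x)%:C)%C = (((1 + x)%:C)%C - v) / ((1 + x)%:C)%C.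
    by rewrite mulrBl divff.
  have xv : cabs (((1 + x)%:C)%C - v) != 0.
    rewrite cabs_eq0; apply/negP => /eqP/eqP; rewrite subr_eq0 => /eqP xv.
    by move: cx; rewrite xv v1; lra.
  rewrite !cabsM !cabsV cx v1; field.
  by rewrite xv gt_eqF.
rewrite P ?mulr_gt0// P//.
have vx (x : R) : 0 <= x -> cabs (1 - v) <= cabs (((1 + x)%:C)%C - v).
  move=> x0; rewrite -(@ler_pXn2r _ 2) ?nnegrE ?cabs_ge0// !cabs_sqr.
  have := cabs_sqr v; rewrite v1 expr1n; case: (v) => a b /= ab.
  have : a <= 1 by have := sqr_ge0 b; nra.
  nra.
have cv : 0 < cabs (1 - v) by lra.
have h1 := vx (2 * s) ltac:(lra); have h2 := vx d (ltW d0).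
have h3 : cabs (((1 + d)%:C)%C - v) <= 2 * cabs (((1 + 2 * s)%:C)%C - v).
  apply: (@le_trans _ _ (d + cabs (1 - v))); last by lra.
  have -> : (((1 + d)%:C)%C - v) = (d%:C)%C + (1 - v) by rewrite rmorphD rmorph1; ring.
  by apply: le_trans (cabsD _ _) _; rewrite cabs_real gtr0_norm.
move: h1 h2 h3; set a := cabs (((1 + 2 * s)%:C)%C - v); set b := cabs (((1 + d)%:C)%C - v) => h1 h2 h3.
have a0 : 0 < a by lra. have b0 : 0 < b by lra.
have -> : 16 * (s / d) * ((2 * d + d ^+ 2) / b ^+ 2) =
    (16 * s * (2 + d)) / b ^+ 2 by field; rewrite !gt_eqF.
rewrite ler_pdivrMr ?exprn_gt0// mulrAC ler_pdivlMr ?exprn_gt0//.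
have b2 : b ^+ 2 <= 4 * a ^+ 2.
  have -> : 4 * a ^+ 2 = (2 * a) ^+ 2 by ring.
  by rewrite lerXn2r// nnegrE; lra.
have a2 : 0 < a ^+ 2 by rewrite exprn_gt0.
apply: (@le_trans _ _ (8 * s * (4 * a ^+ 2))); last first.
  have -> : 8 * s * (4 * a ^+ 2) = 16 * s * 2 * a ^+ 2 by ring.
  by rewrite ler_pM2r// ler_pM2l; lra.
apply: ler_pM => //; rewrite ?exprn_ge0 ?(ltW b0)//; nra.
Qed.

(** A weight bounded by [b] near the point [v^-1] of the circle and by [A]
    elsewhere: the remote part contributes at most a multiple of [A * (s / d)].
    The truncation errors are at most [s], hence at most [s / d]. *)
Lemma herglotz_average_le M (t : 'I_M -> R[i]) (h : 'I_M -> R) v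
    (A b s d : R) :
  (0 < M)%N -> equidistributed t -> (forall j, 0 <= h j <= A) -> 0 <= b ->
  0 < s <= 1 -> 0 < d <= 1 -> cabs v = 1 ->
  2 * (1 + 2 * s)^-1 ^+ M / (1 - (1 + 2 * s)^-1) <= s ->
  2 * (1 + d)^-1 ^+ M / (1 - (1 + d)^-1) <= s ->
  (forall j, cabs (1 - v * t j) < d -> h j <= b) ->
  \sum_j h j * complex.Re (herglotz R M).[v / ((1 + 2 * s)%:C)%C * t j] <=
    M%:R * (2 * b + 34 * (A * (s / d))).
Proof.
move=> M0 tE hA b0 /andP[s0 s1] /andP[d0 d1] v1 es ed near.
pose Ks j := complex.Re (herglotz R M).[v / ((1 + 2 * s)%:C)%C * t j].
pose Kd j := complex.Re (herglotz R M).[v / ((1 + d)%:C)%C * t j].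
have A0 : 0 <= A.
  by have /andP[h0 h1] := hA (Ordinal M0); exact: le_trans h1.
have inv_lt1 (x : R) : 0 < x -> (1 + x)^-1 < 1.
  by move=> x0; rewrite invf_lt1; lra.
have cu (x : R) j : 0 < x -> cabs (v / ((1 + x)%:C)%C * t j) = (1 + x)^-1.
  move=> x0; rewrite !cabsM cabsV tE.1 v1 cabs_real gtr0_norm; last by lra.
  by rewrite mul1r mulr1.
have s20 : 0 < 2 * s by lra.
have Ks0 j : 0 <= Ks j + s.
  by apply: Re_herglotz_ge es => //; rewrite ?inv_lt1// cu.
have Kd0 j : 0 <= Kd j + s.
  by apply: Re_herglotz_ge ed => //; rewrite ?inv_lt1// cu.
have sd0 : 0 < s / d by rewrite divr_gt0.
(* Both terms on the right are nonnegative; the first one dominates near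
   [v^-1], the second one, which involves the kernel of scale [d], elsewhere. *)
have main j : h j * Ks j <=
    b * (Ks j + s) + A * (16 * (s / d) * (Kd j + s) + 2 * s).
  have /andP[h0 h1] := hA j.
  have far0 : 0 <= A * (16 * (s / d) * (Kd j + s) + 2 * s).
    by apply: mulr_ge0 => //; apply: addr_ge0; rewrite ?(ltW s20)// mulr_ge0//; apply: mulr_ge0; rewrite // ltW.
  have near0 : 0 <= b * (Ks j + s) by rewrite mulr_ge0.
  apply: (@le_trans _ _ (h j * (Ks j + s))); first by rewrite ler_wpM2l// lerDl ltW.
  have [cl|cl] := ltP (cabs (1 - v * t j)) d.
    apply: (@le_trans _ _ (b * (Ks j + s))); last by rewrite lerDl.
    by rewrite ler_wpM2r// near.
  apply: (@le_trans _ _ (A * (16 * (s / d) * (Kd j + s) + 2 * s))); last by rewrite lerDr.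
  apply: ler_pM => //.
  have vt1 : cabs (v * t j) = 1 by rewrite cabsM v1 tE.1 mulr1.
  pose P x : R := (1 - (1 + x)^-1 ^+ 2) / cabs (1 - v / ((1 + x)%:C)%C * t j) ^+ 2.
  have ks : Ks j - P (2 * s) <= s.
    have := herglotz_poisson M0 (_ : cabs (v / ((1 + 2 * s)%:C)%C * t j) <= _)
      (inv_lt1 _ s20) es.
    by rewrite cu// => /(_ (lexx _)); rewrite ler_norml => /andP[].
  have kd : - s + P d <= Kd j.
    rewrite -lerBrDr.
    have := herglotz_poisson M0 (_ : cabs (v / ((1 + d)%:C)%C * t j) <= _)
      (inv_lt1 _ d0) ed.
    by rewrite cu// => /(_ (lexx _)); rewrite ler_norml => /andP[].
  have far : P (2 * s) <= 16 * (s / d) * P d.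
    have := @poisson_far_le _ s d vt1 ltac:(by rewrite s0) d0 cl.
    have -> : v * t j / ((1 + 2 * s)%:C)%C = v / ((1 + 2 * s)%:C)%C * t j.
      by rewrite mulrAC.
    have -> : v * t j / ((1 + d)%:C)%C = v / ((1 + d)%:C)%C * t j.
      by rewrite mulrAC.
    by rewrite !cu.
  have h16 : 0 <= 16 * (s / d) by lra.
  have := ler_wpM2l h16 kd; lra.
apply: le_trans (ler_sum _ (fun j _ => main j)) _.
rewrite big_split/= -!mulr_sumr big_split/= sum_Re_herglotz//.
rewrite sumr_const card_ord big_split/= -!mulr_sumr big_split/= sum_Re_herglotz//.
rewrite !sumr_const card_ord.
set m := M%:R.
have m0 : 0 <= m by rewrite ler0n.
have -> : b * (m + s *+ M) + A * (16 * (s / d) * (m + s *+ M) + 2 * (s *+ M)) =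
  m * (b * (1 + s) + A * (16 * (s / d) * (1 + s) + 2 * s)).
  by rewrite -[s *+ M]mulr_natr -/m; ring.
rewrite ler_wpM2l//.
have sd : s <= s / d by rewrite ler_pdivlMr//; nra.
have : A * (16 * (s / d) * (1 + s) + 2 * s) <= A * (34 * (s / d)).
  rewrite ler_wpM2l//; nra.
nra.
Qed.

End herglotz_average.

(** * Discretized outer functions *)

Section discretized_outer_function.
Context (R : realType).
Implicit Types (z w v : R[i]).
Local Notation cabs := (@Normc.normc R).

(** The polynomial analogue of the logarithm of an outer function: a Herglotz
    average over the points [t j], in the disk of radius [1 + 2 * s]. The kernel is
    evaluated at the products [z * t j], so that the value at [z = u^-1], for [u]
    on the circle, depends on the ratios [t j / u]. *)
Definition herglotz_average M (t : 'I_M -> R[i]) (a : 'I_M -> R) (s : R)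
    : {poly R[i]} :=
  \sum_j (a j)%:C%C *: (herglotz R M \Po ((t j / ((1 + 2 * s)%:C)%C) *: 'X)).

Lemma Re_horner_herglotz_average M (t : 'I_M -> R[i]) a s z :
  complex.Re (herglotz_average t a s).[z] =
  \sum_j a j * complex.Re (herglotz R M).[z / ((1 + 2 * s)%:C)%C * t j].
Proof.
rewrite /herglotz_average horner_sum Re_sum; apply: eq_bigr => j _.
rewrite hornerZ Re_realM horner_comp hornerZ hornerX.
by congr (_ * complex.Re (_.[_])); rewrite mulrC mulrCA mulrC.
Qed.

Lemma horner0_herglotz_average M (t : 'I_M -> R[i]) a s :
  (herglotz_average t a s).[0] = ((\sum_j a j)%:C)%C.
Proof.
rewrite /herglotz_average horner_sum rmorph_sum; apply: eq_bigr => j _.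
rewrite hornerZ horner_comp hornerZ hornerX mulr0 hornerE_herglotz.
rewrite big_nat big1 ?mulr0 ?addr0 ?mulr1//.
by move=> k /andP[k0 _]; rewrite expr0n; case: k k0.
Qed.

(** The weights [h j] have mean [S] and their [eps]-averages at the points of the
    circle are at most [E / 2]: there is then a monic polynomial the square of
    whose modulus is at most a multiple of [exp (E - eps * S)]. *)
Lemma small_monic_polynomial M n (t : 'I_M -> R[i]) (h : 'I_M -> R)
    (E : circle R -> R) (A s eps : R) :
  (0 < M)%N -> equidistributed t -> (forall j, 0 <= h j <= A) ->
  0 < s <= 1 -> 0 < eps ->
  2 * ((1 + s) / (1 + 2 * s)) ^+ M / (1 - (1 + s) / (1 + 2 * s)) <= 1 ->
  (forall u : circle R, 0 <= E u) ->
  (forall u : circle R, eps * (\sum_j h j *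
      complex.Re (herglotz R M).[(val u)^-1 / ((1 + 2 * s)%:C)%C * t j]) <=
    M%:R * (E u / 2)) ->
  2 * eps * A + ln s^-1 <= n%:R * (s / 2) ->
  exists q : 'I_n -> R[i], forall u : circle R,
    cabs (\sum_(k < n) q k * val u ^+ k + val u ^+ n) ^+ 2 <=
    4 * expR 1 * expR (E u) * expR (- (eps * ((\sum_j h j) / M%:R))).
Proof.
move=> M0 tE hA /andP[s0 s1] eps0 err E0 avg ns.
have M0' : 0 < M%:R :> R by rewrite ltr0n.
have eM0 : 0 < eps / M%:R by rewrite divr_gt0.
pose a j := eps / M%:R * h j.
pose G := herglotz_average t a s.
have ReG z : complex.Re G.[z] = eps / M%:R *
    \sum_j h j * complex.Re (herglotz R M).[z / ((1 + 2 * s)%:C)%C * t j].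
  rewrite Re_horner_herglotz_average mulr_sumr.
  by apply: eq_bigr => j _; rewrite mulrA.
have s21 : 0 < 1 + 2 * s by lra.
have G0 : G.[0] = ((eps * ((\sum_j h j) / M%:R))%:C)%C.
  rewrite horner0_herglotz_average -mulr_sumr; congr (_%:C)%C.
  by rewrite mulrAC mulrA.
have x0 : 0 <= eps * ((\sum_j h j) / M%:R).
  rewrite mulr_ge0 ?divr_ge0 ?(ltW M0') ?(ltW eps0)//.
  by apply: sumr_ge0 => j _; have /andP[] := hA j.
have Gb z : cabs z = 1 + s -> complex.Re G.[z] <= 2 * eps * A.
  move=> zs; rewrite ReG.
  have := @herglotz_average_le_max R M t h (z / ((1 + 2 * s)%:C)%C) A
    ((1 + s) / (1 + 2 * s)) 1 M0 tE hA.
  rewrite cabsM cabsV zs cabs_real gtr0_norm// => /(_ (lexx _)).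
  rewrite ltr_pdivrMr// => /(_ ltac:(lra) err ler01) hle.
  rewrite mulrAC ler_pdivrMr//.
  apply: le_trans (ler_wpM2l (ltW eps0) hle) _.
  by rewrite le_eqVlt; apply/orP; left; apply/eqP; ring.
have s01 : 0 < s <= 1 by rewrite s0.
have [p [sp p0 pz]] := truncated_exponential s01 x0 G0 Gb ns.
have [q qE] := monic_reversal sp p0.
exists q => u; rewrite qE ?cabs_circle//.
apply: le_trans (pz _ _) _; first by rewrite cabsV cabs_circle invr1.
rewrite ler_wpM2r ?expR_ge0//.
have : expR (2 * complex.Re G.[(val u)^-1] + 1) <= expR 1 * expR (E u).
  rewrite -expRD ler_expR addrC lerD2l ReG.
  have := avg u; set S := \sum_j _ => hS.
  have : eps / M%:R * S <= E u / 2 by rewrite mulrAC ler_pdivrMr// [E u / 2 * _]mulrC.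
  lra.
have : expR 1 <= expR 1 * expR (E u).
  by rewrite ler_peMr ?expR_ge0// -expR0 ler_expR.
lra.
Qed.

End discretized_outer_function.

(** * The profile [phi] *)

Section profile.
Local Open Scope ereal_scope.
Context (R : realType) (phi : R -> \bar R).
Context (phi_continuous : {within `[0%R, (2^-1)%R], continuous phi})
    (phi_decreasing : forall x y : R,
       (0 <= x)%R -> (x < y)%R -> (y <= 2^-1)%R -> phi y < phi x)
    (phi_gt0 : forall x : R, (0 <= x <= 2^-1)%R -> 0 < phi x)
    (phi_finite : forall x : R, (0 < x <= 2^-1)%R -> phi x < +oo)
    (phi_regular : regular phi).
Local Notation f x := (fine (phi x)).
Local Open Scope ring_scope.

Lemma profile_fineE x : 0 < x <= 2^-1 -> phi x = (f x)%:E.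
Proof.
move=> /andP[x0 x2]; rewrite fineK// ge0_fin_numE ?phi_finite ?x0//.
by apply/ltW/phi_gt0; rewrite x2 ltW.
Qed.

Lemma profile_nonincreasing x y : 0 <= x -> x <= y -> y <= 2^-1 ->
  (phi y <= phi x)%E.
Proof.
move=> x0; rewrite le_eqVlt => /predU1P[->//|xy] y2.
exact/ltW/phi_decreasing.
Qed.

Lemma fine_profile_nonincreasing x y : 0 < x -> x <= y -> y <= 2^-1 ->
  f y <= f x.
Proof.
move=> x0 xy y2; rewrite -lee_fin -!profile_fineE ?x0 ?y2 ?(le_trans xy)//.
  exact: profile_nonincreasing (ltW x0) _ _.
by rewrite (lt_le_trans x0).
Qed.

Lemma fine_profile_gt0 x : 0 < x <= 2^-1 -> 0 < f x.
Proof.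
move=> x02; rewrite -lte_fin -profile_fineE// phi_gt0//.
by case/andP: x02 => /ltW -> ->.
Qed.

Lemma profile_unbounded (Y : R) : exists2 a, 0 < a <= 2^-1 & Y <= f a.
Proof.
have h2 : 0 < 2^-1 :> R by rewrite invr_gt0.
case: phi_regular => [[_ [c1 c10 hc]]|[C2 [c2 [_ c20 hc]]]].
- pose a := Num.min 2^-1 (expR (- (Y / c1))).
  have a02 : 0 < a <= 2^-1 by rewrite lt_min h2 expR_gt0 ge_min lexx.
  exists a => //; have := hc a a02; rewrite profile_fineE// lee_fin.
  apply: le_trans; rewrite -ler_pdivrMl// mulrC -[Y / c1]expRK.
  case/andP: a02 => a0 _.
  rewrite ler_ln ?posrE ?expR_gt0 ?invr_gt0//.
  by rewrite -[expR _]invrK -expRN lef_pV2 ?posrE ?expR_gt0// ge_min lexx orbT.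
- pose a := Num.min 2^-1 (c2 / (`|Y| + 1)).
  have Y1 : 0 < `|Y| + 1 by rewrite ltr_wpDl.
  have a02 : 0 < a <= 2^-1 by rewrite lt_min h2 divr_gt0//= ge_min lexx.
  exists a => //; have [_] := hc a a02; rewrite profile_fineE// lee_fin.
  apply: le_trans; case/andP: a02 => a0 _.
  rewrite ler_pdivlMr//; apply: (@le_trans _ _ ((`|Y| + 1) * a)).
    by rewrite ler_pM2r//; have := ler_norm Y; lra.
  by rewrite -ler_pdivlMl// mulrC /a ge_min lexx orbT.
Qed.

Lemma profile_doubling :
  exists2 D : R, 1 <= D & forall x, 0 < x <= 2^-1 -> f (x / 2) <= D * f x.
Proof.
have half (x : R) : 0 < x <= 2^-1 -> 0 < x / 2 <= 2^-1 by lra.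
case: phi_regular => [[hm _]|[C2 [c2 [C20 _ hC]]]].
- exists 2; first by rewrite ler1n.
  move=> x x02; have /andP[x0 x2] := x02.
  have h : x / 2 <= x by lra.
  have := hm (x / 2) x ltac:(lra) h x2.
  rewrite (profile_fineE (half _ x02)) (profile_fineE x02) -!EFinM lee_fin mulrAC ler_pdivrMr//.
  by rewrite -mulrA ler_pM2l// [_ * 2]mulrC.
- exists (Num.max 1 C2); first by rewrite le_max lexx.
  move=> x x02; have [+ _] := hC x x02.
  rewrite (profile_fineE (half _ x02)) (profile_fineE x02) -EFinM lee_fin => /le_trans; apply.
  by rewrite ler_pM2r ?fine_profile_gt0// le_max lexx orbT.
Qed.

Lemma fine_profile_continuous a : 0 < a -> {within `[a, 2^-1], continuous (fun x => fine (phi x))}.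
Proof.
move=> a0.
have : {within `[a, 2^-1], continuous phi}.
  apply: continuous_subspaceW phi_continuous => x /=.
  by rewrite !in_itv/= => /andP[/(le_trans (ltW a0)) -> ->].
move=> /subspace_continuousP hc; apply/subspace_continuousP => x xa.
apply: fine_cvg; rewrite -profile_fineE; first exact: hc.
by move: xa; rewrite /= in_itv/= => /andP[/(lt_le_trans a0) -> ->].
Qed.

(** The graph of the profile meets every nondecreasing line which lies above it
    at [1 / 2]. Horizontal lines give the inverse of the profile, lines through
    the origin the solution of the level equation. *)
Lemma profile_meets_line (Y m : R) : 0 <= m -> f 2^-1 <= Y + m * 2^-1 ->
  exists2 x, 0 < x <= 2^-1 & phi x = (Y + m * x)%:E.
Proof.
move=> m0 fY.
have [a a02 fa] := profile_unbounded (Y + m * 2^-1).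
have /andP[a0 a2] := a02.
pose g x := f x - m * x.
have gc : {within `[a, 2^-1], continuous g}.
  move=> x; apply: cvgB; first exact: (fine_profile_continuous a0).
  apply: continuous_subspaceT => y; apply: cvgM; [exact: cvg_cst|exact: cvg_id].
have h : Num.min (g a) (g 2^-1) <= Y <= Num.max (g a) (g 2^-1).
  rewrite /g ge_min le_max; apply/andP; split.
    by apply/orP; right; rewrite lerBlDr.
  by apply/orP; left; rewrite lerBrDr; apply: le_trans fa; rewrite lerD2l ler_wpM2l.
have [x xa gx] := IVT a2 gc h.
have x02 : 0 < x <= 2^-1.
  by move: xa; rewrite in_itv/= => /andP[/(lt_le_trans a0) -> ->].
by exists x => //; rewrite profile_fineE// -gx /g subrK.
Qed.

End profile.

(** * Arguments of points of the circle *)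

Section circle_coordinates.
Context (R : realType).
Implicit Types (t u : circle R).
Local Notation cabs := (@Normc.normc R).
Local Notation e x := (val (cexp2pi x) : R[i]).

Lemma cexp2pi_surj t : exists2 x : R, - 2^-1 <= x <= 2^-1 & t = cexp2pi x.
Proof.
have p0 := pi_gt0 R.
have [a [b tE]] : exists a b, val t = Complex a b.
  by case: (val t) => a b; exists a, b.
have ab : a ^+ 2 + b ^+ 2 = 1.
  by have := cabs_sqr (val t); rewrite cabs_circle expr1n tE.
have a1 : -1 <= a <= 1 by have := sqr_ge0 b; nra.
have sE : sin (acos a) = `|b|.
  by rewrite sin_acos// -ab addrAC subrr add0r sqrtr_sqr.
have x01 : 0 <= acos a / (2 * pi) <= 2^-1.
  apply/andP; split; first by rewrite divr_ge0 ?acos_ge0// mulr_ge0// pi_ge0.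
  by rewrite ler_pdivrMr ?mulr_gt0// mulKf ?acos_lepi.
have xE : 2 * pi * (acos a / (2 * pi)) = acos a.
  by rewrite mulrC divfK// mulf_neq0// gt_eqF.
have [b0|b0] := leP 0 b.
  exists (acos a / (2 * pi)); first by lra.
  by apply: val_inj; rewrite tE /= xE acosK ?in_itv//= sE ger0_norm.
exists (- (acos a / (2 * pi))); first by lra.
by apply: val_inj; rewrite tE /= mulrN xE cosN sinN acosK ?in_itv//= sE ltr0_norm// opprK.
Qed.

(** Circle points at chordal distance less than [g] have arguments differing
    by less than [g / 2], in turns. *)
Lemma chord_lt_arc (x : R) t (g : R) : - 2^-1 <= x <= 2^-1 ->
  cabs (1 - (e x)^-1 * val t) < g ->
  exists2 y, `|y| < g / 2 & t = cexp2pi (x + y).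
Proof.
move=> x2; have [z z2 ->] := cexp2pi_surj t; rewrite -cexp2piN -cexp2piD => cg.
have [y [y2 eyE tE]] : exists y, [/\ `|y| <= 2^-1, e y = e (- x + z) &
    cexp2pi z = cexp2pi (x + y)].
  have [d1|d1] := ltP (- x + z) (- 2^-1).
    exists (- x + z + 1); split.
    - by rewrite ler_norml; lra.
    - by rewrite cexp2piD cexp2pi1 mulr1.
    - apply: val_inj; rewrite (_ : x + _ = z + 1); last by ring.
      by rewrite cexp2piD cexp2pi1 mulr1.
  have [d2|d2] := ltP 2^-1 (- x + z).
    exists (- x + z - 1); split.
    - by rewrite ler_norml; lra.
    - by rewrite cexp2piD cexp2piN cexp2pi1 invr1 mulr1.
    - apply: val_inj; rewrite (_ : x + _ = z - 1); last by ring.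
      by rewrite cexp2piD cexp2piN cexp2pi1 invr1 mulr1.
  exists (- x + z); split => //; first by rewrite ler_norml; lra.
  by congr cexp2pi; ring.
exists y => //; have := chord_ge y2; rewrite eyE; lra.
Qed.

End circle_coordinates.

(** * Subordinated functions and their truncations *)

Section truncation.
Context (R : realType) (H : circle R -> \bar R).

(** The truncation of [H] at height [A], as a real-valued function. *)
Definition truncation (A : R) (t : circle R) : R := fine (mine (H t) A%:E).

Context (H_ge0 : forall t, (0 <= H t)%E).

Lemma truncation_ge0 A t : 0 <= A -> 0 <= truncation A t.
Proof.
by move=> A0; rewrite /truncation fine_ge0// le_min H_ge0 lee_fin.
Qed.

Lemma truncationE A t : 0 <= A -> (truncation A t)%:E = mine (H t) A%:E.
Proof.
move=> A0; rewrite fineK// ge0_fin_numE ?le_min ?H_ge0 ?lee_fin//.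
by rewrite gt_min ltry orbT.
Qed.

Lemma truncation_le A t : 0 <= A -> truncation A t <= A.
Proof. by move=> A0; rewrite -lee_fin truncationE// ge_min lexx orbT. Qed.

Lemma truncation_le_H A t : 0 <= A -> ((truncation A t)%:E <= H t)%E.
Proof. by move=> A0; rewrite truncationE// ge_min lexx. Qed.

Lemma truncation_high A t : 0 <= A -> (A%:E <= H t)%E -> truncation A t = A.
Proof. by move=> A0 AH; apply: EFin_inj; rewrite truncationE// min_r. Qed.

End truncation.

Section subordination.
Context (R : realType) (phi : R -> \bar R).
Context (phi_continuous : {within `[0%R, (2^-1)%R], continuous phi})
    (phi_decreasing : forall x y : R,
       (0 <= x)%R -> (x < y)%R -> (y <= 2^-1)%R -> (phi y < phi x)%E)
    (phi_gt0 : forall x : R, (0 <= x <= 2^-1)%R -> (0 < phi x)%E)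
    (phi_finite : forall x : R, (0 < x <= 2^-1)%R -> (phi x < +oo)%E)
    (phi_regular : regular phi).
Context (H : circle R -> \bar R) (H_ge0 : forall t, (0 <= H t)%E)
    (phi_le_H : (phi (2^-1)%R <= ereal_inf (range H))%E)
    (H_subordinated : subordinated H phi).
Context (D : R) (D1 : 1 <= D).
Local Notation f x := (fine (phi x)).
Context (doubling : forall x : R, 0 < x <= 2^-1 -> f (x / 2) <= D * f x).
Local Notation cabs := (@Normc.normc R).
Local Notation e x := (val (cexp2pi x) : R[i]).

(** Subordination makes [H] slowly varying at scale [phi^{-1} (H)]. *)
Lemma subordinated_near (x y g : R) : - 2^-1 <= x <= 2^-1 -> 0 < g <= 2^-1 ->
  phi g = H (cexp2pi x) -> `|y| <= g / 2 ->
  (H (cexp2pi (x + y)) <= (D * f g)%:E)%E.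
Proof.
move=> x2 g2 gH yg; have /andP[g0 g2'] := g2.
have gy : g / 2 <= g - `|y| by lra.
apply: (@le_trans _ _ (phi (g - `|y|))).
  have g02 : 0 <= g <= 2^-1 by rewrite ltW.
  have [hl hr] := H_subordinated x2 g02 gH.
  have [y0|y0] := leP 0 y.
    move: yg; rewrite ger0_norm// => yg.
    have := hr (x + y) ltac:(lra).
    by rewrite (_ : x + g - (x + y) = g - y)//; ring.
  move: yg; rewrite ltr0_norm// => yg.
  have := hl (x + y) ltac:(lra).
  by rewrite (_ : x + y + g - x = g - - y)//; ring.
apply: (@le_trans _ _ (phi (g / 2))).
  by apply: profile_nonincreasing; [| |move: gy|]; have := normr_ge0 y; try lra.
by rewrite (profile_fineE phi_gt0 phi_finite) ?lee_fin ?doubling//; lra.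
Qed.

Lemma truncation_low A t : (H t < A%:E)%E ->
  exists2 g, 0 < g <= 2^-1 & phi g = H t /\ truncation H A t = f g.
Proof.
move=> HA; have Hfin : H t \is a fin_num.
  by rewrite ge0_fin_numE// (lt_trans HA)// ltry.
have phi2 : f 2^-1 <= fine (H t) + 0 * 2^-1.
  rewrite mul0r addr0 -lee_fin (fineK Hfin) -(profile_fineE phi_gt0 phi_finite).
    apply: le_trans phi_le_H _; apply: ereal_inf_lbound; by exists t.
  by rewrite lexx invr_gt0 ltr0n.
have [g g2 gE] := profile_meets_line phi_continuous phi_gt0 phi_finite phi_regular (lexx 0) phi2.
have gH : phi g = H t by rewrite gE mul0r addr0 fineK.
by exists g => //; split=> //; rewrite /truncation gH min_l// ltW.
Qed.

(** Where [H < A], the argument of the profile exceeds [d]; so the truncation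
    at height [A] is slowly varying at the uniform scale [d]. *)
Lemma truncation_near A (x y : R) (d : R) : 0 < A -> - 2^-1 <= x <= 2^-1 ->
  0 < d <= 2^-1 -> A <= f d -> `|y| <= d / 2 ->
  truncation H A (cexp2pi (x + y)) <= D * truncation H A (cexp2pi x).
Proof.
move=> A0 x2 d2 Ad yd; have A0' := ltW A0.
have [AH|HA] := leP A%:E (H (cexp2pi x)).
  rewrite (truncation_high H_ge0 _ AH)//; apply: le_trans (truncation_le H_ge0 _ A0') _.
  by rewrite ler_peMl.
have [g g2 [gH ->]] := truncation_low HA.
rewrite -lee_fin; apply: le_trans (truncation_le_H H_ge0 _ A0') _.
apply: subordinated_near => //; apply: le_trans yd _; rewrite ler_pM2r ?invr_gt0//.
rewrite leNgt; apply/negP => gd.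
have gfA : f g < A by rewrite -lte_fin -(profile_fineE phi_gt0 phi_finite)// gH.
have /andP[g0 _] := g2; have /andP[_ dd] := d2.
have := fine_profile_nonincreasing phi_decreasing phi_gt0 phi_finite g0 (ltW gd) dd.
lra.
Qed.

(** The Poisson average of scale [s] of the truncation of [H] is at most a
    multiple of the truncation itself. Near [u] this is slow variation; away
    from [u] the truncation is only bounded by [A], and the tail of the Poisson
    kernel is compensated by the lower bound on [x * phi x]. *)
Lemma truncation_average_le (K s A d : R) M (t : 'I_M -> circle R) (u : circle R) :
  0 < A -> 0 < s <= 1 -> 0 < d <= 2^-1 -> A <= f d -> 0 <= K ->
  (forall x : R, 0 < x <= 2^-1 -> f x <= A -> s * A <= K * (x * f x)) ->
  (0 < M)%N -> equidistributed (fun j => val (t j)) ->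
  2 * (1 + 2 * s)^-1 ^+ M / (1 - (1 + 2 * s)^-1) <= s ->
  2 * (1 + d)^-1 ^+ M / (1 - (1 + d)^-1) <= s ->
  \sum_j truncation H A (t j) * complex.Re
      (herglotz R M).[(val u)^-1 / ((1 + 2 * s)%:C)%C * val (t j)] <=
    M%:R * ((2 * D + 34 * K) * truncation H A u).
Proof.
move=> A0 s01 d2 Ad K0 hK M0 tE es ed; have A0' := ltW A0.
have M0' : 0 <= M%:R :> R by rewrite ler0n.
have hA (j : 'I_M) : 0 <= truncation H A (t j) <= A.
  by rewrite truncation_ge0// truncation_le.
have /andP[s0 s1] := s01.
have D1' : 1 <= D := D1.
have u1 : cabs (val u)^-1 = 1 by rewrite cabsV cabs_circle invr1.
have [AH|HA] := leP A%:E (H u).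
  rewrite (truncation_high H_ge0 A0' AH).
  have i1 : (1 + 2 * s)^-1 < 1 by rewrite invf_lt1; lra.
  have := @herglotz_average_le_max R M (fun j => val (t j))
    (fun j => truncation H A (t j)) ((val u)^-1 / ((1 + 2 * s)%:C)%C) A _ s M0 tE hA
    (_ : cabs _ <= (1 + 2 * s)^-1) i1 es (ltW s0).
  rewrite cabsM u1 cabsV cabs_real gtr0_norm ?mul1r; last by lra.
  move=> /(_ (lexx _)) /le_trans; apply.
  have DK : 1 + s <= 2 * D + 34 * K by lra.
  by rewrite ler_wpM2l// [A * _]mulrC ler_wpM2r.
have [g g2 [gH gE]] := truncation_low HA.
have fg0 := fine_profile_gt0 phi_gt0 phi_finite g2.
have /andP[g0 g2'] := g2.
have fgA : f g < A by rewrite -lte_fin -(profile_fineE phi_gt0 phi_finite)// gH.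
have dg : d <= g.
  rewrite leNgt; apply/negP => gd; have /andP[_ dd] := d2.
  have := fine_profile_nonincreasing phi_decreasing phi_gt0 phi_finite g0 (ltW gd) dd.
  lra.
have /andP[d0 _] := d2.
(* The far part is cut at chordal distance [g]. *)
have near (j : 'I_M) : cabs (1 - (val u)^-1 * val (t j)) < g ->
    truncation H A (t j) <= D * f g.
  have [x x2 uE] := cexp2pi_surj u; rewrite uE => /(chord_lt_arc x2)[y yg ->].
  rewrite -lee_fin; apply: le_trans (truncation_le_H H_ge0 _ A0') _.
  by apply: subordinated_near => //; rewrite -?uE// ltW.
have Dfg : 0 <= D * f g by apply: mulr_ge0; lra.
have g01 : 0 < g <= 1 by lra.
have := @herglotz_average_le R M (fun j => val (t j))
  (fun j => truncation H A (t j)) (val u)^-1 A (D * f g) s g M0 tE hA Dfg s01 g01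
  u1 es (le_trans (herglotz_error_le _ d0 dg) ed) near.
move=> /le_trans; apply; rewrite ler_wpM2l// gE.
have : A * (s / g) <= K * f g.
  rewrite mulrA ler_pdivrMr// mulrC -mulrA [f g * g]mulrC.
  by apply: hK => //; exact: ltW.
lra.
Qed.

(** The polynomial which witnesses the upper bound for the distance, together
    with a mesh over which the truncation of [H] is slowly varying. *)
Lemma subordinated_polynomial (K s A eps : R) (n : nat) :
  0 < A -> 0 < s <= 1 -> 0 <= K -> 0 < eps -> eps * (4 * D + 68 * K) <= 1 ->
  (forall x : R, 0 < x <= 2^-1 -> f x <= A -> s * A <= K * (x * f x)) ->
  2 * eps * A + ln s^-1 <= n%:R * (s / 2) ->
  exists M : nat, let x (j : 'I_M) := j%:R / M%:R - 2^-1 in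
  [/\ (0 < M)%N,
    forall j y, `|y| <= M%:R^-1 ->
      truncation H A (cexp2pi (x j + y)) <= D * truncation H A (cexp2pi (x j)) &
    exists q : 'I_n -> R[i], forall u : circle R,
      cabs (\sum_(k < n) q k * val u ^+ k + val u ^+ n) ^+ 2 <=
      4 * expR 1 * expR (truncation H A u) *
      expR (- (eps * ((\sum_j truncation H A (cexp2pi (x j))) / M%:R)))].
Proof.
move=> A0 s01 K0 eps0 epsK hK ns; have A0' := ltW A0.
have /andP[s0 s1] := s01.
have D1' : 1 <= D := D1.
have [d d2 Ad] := profile_unbounded phi_gt0 phi_finite phi_regular A.
have /andP[d0 _] := d2.
have i1 (x : R) : 0 < x -> 0 <= (1 + x)^-1 < 1.
  by move=> x0; rewrite invr_ge0 invf_lt1; lra.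
have s21 : 0 < 1 + 2 * s by lra.
have [M1 hM1] := @herglotz_error_small R _ s (i1 (2 * s) ltac:(lra)) s0.
have [M2 hM2] := @herglotz_error_small R _ s (i1 d d0) s0.
have [|M3 hM3] := @herglotz_error_small R ((1 + s) / (1 + 2 * s)) 1 _ ltr01.
  by rewrite divr_ge0 ?ltr_pdivrMr//; lra.
(* Three thresholds on [M] come from the truncation errors of the kernel; the
   last one makes the mesh finer than [d / 2]. *)
pose M4 := Num.bound (2 / d).
have hM4 : 2 / d < M4%:R by apply: archi_boundP; rewrite divr_ge0// ltW.
pose M := (maxn M1 (maxn M2 (maxn M3 M4)) + 1)%N.
have M0 : (0 < M)%N by rewrite /M addn1.
have M0' : 0 < M%:R :> R by rewrite ltr0n.
have [lM1 lM2 lM3 lM4] : [/\ (M1 <= M)%N, (M2 <= M)%N, (M3 <= M)%N & (M4 <= M)%N].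
  by rewrite /M; split; apply: leq_trans (leq_addr _ _); rewrite !leq_max leqnn ?orbT.
exists M => x; split=> //.
  move=> j y yM; apply: truncation_near d2 Ad _ => //.
    have jM : j%:R / M%:R < 1 :> R by rewrite ltr_pdivrMr// mul1r ltr_nat.
    have j0 : 0 <= j%:R / M%:R :> R by rewrite divr_ge0.
    by rewrite /x; lra.
  apply: le_trans yM _; rewrite -[d / 2]invrK lef_pV2 ?posrE ?invr_gt0 ?divr_gt0//.
  rewrite invf_div; apply: le_trans (ltW hM4) _.
  by rewrite ler_nat.
pose t (j : 'I_M) := cexp2pi (x j).
have tE : equidistributed (fun j => val (t j)) by exact: equidistributed_circle.
apply: (@small_monic_polynomial R M n (fun j => val (t j))
  (fun j => truncation H A (t j)) (truncation H A) A s eps) => //.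
- by move=> j; rewrite truncation_ge0// truncation_le.
- exact: hM3.
- by move=> u; rewrite truncation_ge0.
move=> u; have := @truncation_average_le K s A d M t u A0 s01 d2 Ad K0 hK M0 tE
  (hM1 _ lM1) (hM2 _ lM2).
move=> /(ler_wpM2l (ltW eps0)) /le_trans; apply.
rewrite mulrCA ler_wpM2l ?(ltW M0')// mulrA mulrC ler_wpM2l ?truncation_ge0//.
lra.
Qed.
End subordination.

(** * Measurability on the circle *)

Section circle_measurability.
Context (R : realType).
Local Notation cabs := (@Normc.normc R).

Let complex_measurable (F : circle R -> R[i]) : Prop :=
  measurable_fun setT (fun t => complex.Re (F t)) /\
  measurable_fun setT (fun t => complex.Im (F t)).

Let complex_measurable_cst (z : R[i]) : complex_measurable (fun=> z).
Proof. by split; exact: measurable_cst. Qed.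

Let complex_measurable_val : complex_measurable (fun t => val t).
Proof.
have mc : measurable_fun setT (@circle_coord R).
  by move=> _ B mB; exists B.
by split; [exact: (measurableT_comp measurable_fst mc)|
  exact: (measurableT_comp measurable_snd mc)].
Qed.

Let complex_measurableD F G : complex_measurable F -> complex_measurable G ->
  complex_measurable (fun t => F t + G t).
Proof.
move=> [F1 F2] [G1 G2]; split.
  apply: (eq_measurable_fun (fun t => complex.Re (F t) + complex.Re (G t))).
    by move=> t _; case: (F t) (G t) => a b [].
  exact: measurable_funD.
apply: (eq_measurable_fun (fun t => complex.Im (F t) + complex.Im (G t))).
  by move=> t _; case: (F t) (G t) => a b [].
exact: measurable_funD.
Qed.

Let complex_measurableM F G : complex_measurable F -> complex_measurable G ->
  complex_measurable (fun t => F t * G t).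
Proof.
move=> [F1 F2] [G1 G2]; split.
  apply: (eq_measurable_fun (fun t => complex.Re (F t) * complex.Re (G t) -
      complex.Im (F t) * complex.Im (G t))).
    by move=> t _; case: (F t) (G t) => a b [].
  by apply: measurable_funB; exact: measurable_funM.
apply: (eq_measurable_fun (fun t => complex.Re (F t) * complex.Im (G t) +
    complex.Im (F t) * complex.Re (G t))).
  by move=> t _; case: (F t) (G t) => a b [].
by apply: measurable_funD; exact: measurable_funM.
Qed.

Lemma measurable_monic_sqr n (q : 'I_n -> R[i]) :
  measurable_fun setT (fun t : circle R =>
    cabs (\sum_(k < n) q k * val t ^+ k + val t ^+ n) ^+ 2).
Proof.
have mX k : complex_measurable (fun t => val t ^+ k).
  elim: k => [|k IH].
    under eq_fun do rewrite expr0; exact: complex_measurable_cst.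
  under eq_fun do rewrite exprS; exact: complex_measurableM.
have : complex_measurable
    (fun t => \sum_(k < n) q k * val t ^+ k + val t ^+ n).
  apply: complex_measurableD => //; elim: (index_enum _) => [|k r IH].
    under eq_fun do rewrite big_nil; exact: complex_measurable_cst.
  under eq_fun do rewrite big_cons; apply: complex_measurableD => //.
  by apply: complex_measurableM => //; exact: complex_measurable_cst.
move=> [m1 m2]; under eq_fun do rewrite cabs_sqr.
by apply: measurable_funD; exact: measurable_funX.
Qed.

End circle_measurability.

(** * Means of truncations *)

Section truncated_mean.
Local Open Scope ereal_scope.
Context (R : realType) (H : circle R -> \bar R).
Context (H_measurable : measurable_fun setT H) (H_ge0 : forall t, 0 <= H t).

Lemma measurable_truncation (A : R) : measurable_fun setT (truncation H A).
Proof.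
apply: measurableT_comp => //.
by apply: measurable_mine => //; exact: measurable_cst.
Qed.

(** The tail formula for the mean; below [A] the function and its
    truncation have the same distribution function. *)
Lemma int_distr_fun_le (A : R) : (0 <= A)%R ->
  \int[lebesgue_measure]_(a in `[0%R, A]) distr_fun H a <=
  \int[circle_measure R]_t (truncation H A t)%:E.
Proof.
move=> A0.
pose X : {RV (circle_measure R) >-> R} := mfun_Sub (mem_set (measurable_truncation A)).
have XE t : X t = truncation H A t by [].
have X0 t : (0 <= X t)%R by rewrite XE truncation_ge0.
have -> : \int[circle_measure R]_t (truncation H A t)%:E = 'E_(circle_measure R)[X].
  by rewrite expectation_def.
have cE a : (a < A)%R -> ccdf X a = distr_fun H a.
  move=> aA; rewrite /ccdf /distribution /pushforward /distr_fun; congr circle_measure.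
  apply/seteqP; split => t /=; rewrite in_itv/= andbT.
    by rewrite -lte_fin truncationE// lt_min => /andP[].
  by move=> aH; rewrite -lte_fin truncationE// lt_min aH lte_fin.
have mc : measurable_fun `[0%R, A[ (distr_fun H).
  apply: (eq_measurable_fun (ccdf X)).
    by move=> a; rewrite inE/= in_itv/= => /andP[_ /cE].
  exact: measurable_funTS (ccdf_measurable X).
rewrite -integral_itv_bndo_bndc// ge0_expectation_ccdf//.
have -> : \int[lebesgue_measure]_(a in `[0%R, A[) distr_fun H a =
    \int[lebesgue_measure]_(a in `[0%R, A[) ccdf X a.
  by apply: eq_integral => a; rewrite inE/= in_itv/= => /andP[_ /cE].
apply: ge0_subset_integral => //.
- exact: measurable_funTS (ccdf_measurable X).
- by move=> a /=; rewrite !in_itv/= andbT => /andP[].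
Qed.

Lemma mean_truncation_unbounded (Y : R) : \int[circle_measure R]_t H t = +oo ->
  exists2 A0 : R, (0 <= A0)%R & forall A, (A0 <= A)%R ->
    Y%:E <= \int[circle_measure R]_t (truncation H A t)%:E.
Proof.
move=> Hoo.
pose g (n : nat) t := (truncation H n%:R t)%:E.
have mg n : measurable_fun setT (g n).
  by apply/measurable_EFinP; exact: measurable_truncation.
have g0 n t : [set: circle R] t -> 0 <= g n t.
  by move=> _; rewrite lee_fin truncation_ge0.
have gE n t : g n t = mine (H t) n%:R%:E by rewrite /g truncationE.
have gm t : [set: circle R] t -> {homo g^~ t : n m / (n <= m)%N >-> n <= m}.
  move=> _ n m nm; rewrite !gE le_min ge_min lexx/= ge_min.
  by rewrite lee_fin ler_nat nm orbT.
have := @cvg_monotone_convergence _ _ R (circle_measure R) _ measurableT g mg g0 gm.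
have -> : \int[circle_measure R]_t limn (g^~ t) = +oo.
  rewrite -Hoo; apply: eq_integral => t _; apply/cvg_lim => //.
  rewrite (_ : g^~ t = fun n => mine (H t) n%:R%:E); last by apply/funext => n.
  case: (H t) (H_ge0 t) => [r r0|_|//].
    apply: (cvg_near_cst r%:E); near=> n; apply: min_l; rewrite lee_fin.
    by near: n; exact: nbhs_infty_ger.
  apply/cvgeyPge => Z; near=> n; rewrite min_r ?leey// lee_fin.
  by near: n; exact: nbhs_infty_ger.
move=> /cvgeyPge /(_ Y) [n _ hn].
exists n%:R => // A nA.
apply: le_trans (hn n (leqnn n)) _.
apply: ge0_le_integral => //.
- by move=> t _; exact: g0.
- by apply/measurable_EFinP; exact: measurable_truncation.
- move=> t _; rewrite gE truncationE ?(le_trans _ nA)//.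
  by rewrite le_min ge_min lexx/= ge_min lee_fin nA orbT.
Unshelve. all: by end_near. Qed.

(** A function dominated on each arc of a mesh by a constant has its mean
    dominated by the average of the constants. *)
Lemma mean_le_mesh M (X : circle R -> R) (A : R) (h : 'I_M -> R) :
  measurable_fun setT X -> (forall t, 0 <= X t <= A)%R -> (0 < M)%N ->
  (forall j, 0 <= h j)%R ->
  (forall (j : 'I_M) (y : R), `|y| <= M%:R^-1 ->
    X (cexp2pi (j%:R / M%:R - 2^-1 + y)) <= h j)%R ->
  \int[circle_measure R]_t (X t)%:E <= ((\sum_j h j) / M%:R)%:E.
Proof.
move=> mX XA M0 h0 hX; have M0' : (0 < M%:R :> R)%R by rewrite ltr0n.
pose I : set R := `[(- 2^-1)%R, 2^-1%R[%classic.
pose mu : {measure set (measurableTypeR R) -> \bar R} :=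
  mrestr lebesgue_measure (measurable_itv `[(- 2^-1)%R : R, 2^-1%R[).
rewrite [leLHS](_ : _ = \int[mu]_x (X (cexp2pi x))%:E); last first.
  transitivity (\int[pushforward mu (@cexp2pi R)]_t (X t)%:E).
    by apply: eq_measure_integral; first exact: measurable_cexp2pi.
  rewrite ge0_integral_pushforward//.
  - exact: measurable_cexp2pi.
  - exact/measurable_EFinP.
  by move=> t _; rewrite lee_fin; have /andP[] := XA t.
pose x (j : 'I_M) : R := (j%:R / M%:R - 2^-1)%R.
(* [X] composed with the parametrization is dominated by [b] on the fundamental
   interval [I], which carries the measure, and by [A] elsewhere. *)
pose C (j : 'I_M) : set R := `[x j, (x j + M%:R^-1)%R[%classic.
pose b (y : R) := \sum_(j < M) (h j)%:E * (\1_(C j) y)%:E.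
have mC j : measurable (C j) by exact: measurable_itv.
have mI : measurable I by exact: measurable_itv.
have A0 : (0 <= A)%R by have /andP[a1 a2] := XA point; exact: le_trans a2.
have mind (B : set R) : measurable B ->
    measurable_fun setT (fun y : R => (\1_B y)%:E : \bar R).
  by move=> mB; apply/measurable_EFinP; exact: measurable_indic.
have b0 (y : R) : 0 <= b y.
  by apply: sume_ge0 => j _; rewrite mule_ge0// lee_fin.
have mCj j : measurable_fun setT (fun y : R => (h j)%:E * (\1_(C j) y)%:E).
  by apply: measurable_funeM; exact: mind.
have mb : measurable_fun setT b by apply: emeasurable_sum.
have mA : measurable_fun setT (fun y : R => A%:E * (\1_(~` I) y)%:E).
  by apply: measurable_funeM; apply: mind; exact: measurableC.
apply: (@le_trans _ _ (\int[mu]_y (b y + A%:E * (\1_(~` I) y)%:E))).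
  apply: ge0_le_integral => //.
  - by move=> y _; rewrite lee_fin; have /andP[] := XA (cexp2pi y).
  - apply/measurable_EFinP; exact: (measurableT_comp mX (@measurable_cexp2pi R)).
  - by apply: emeasurable_funD.
  move=> y _; have [Iy|Iy] := pselect (I y); last first.
    apply: (@le_trans _ _ (A%:E * (\1_(~` I) y)%:E)); last by rewrite leeDr.
    by rewrite indicE mem_set// mule1 lee_fin; have /andP[] := XA (cexp2pi y).
  apply: (@le_trans _ _ (b y)); last by rewrite leeDl// mule_ge0// lee_fin.
  move: Iy; rewrite /I /= in_itv/= => /andP[y1 y2].
  have z0 : (0 <= (y + 2^-1) * M%:R)%R by rewrite mulr_ge0 ?(ltW M0')//; lra.
  have zM : (Num.truncn ((y + 2^-1) * M%:R) < M)%N.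
    rewrite -(ltr_nat R); apply: (@le_lt_trans _ _ ((y + 2^-1) * M%:R)%R).
      by rewrite truncn_le.
    by rewrite gtr_pMl//; lra.
  have /andP[k1 k2] := truncn_itv z0.
  have yx : (0 <= y - x (Ordinal zM) < M%:R^-1)%R.
    move: k1 k2; rewrite /x /=; set k := Num.truncn _ => k1 k2.
    rewrite -ler_pdivrMr// in k1.
    rewrite -ltr_pdivlMr// -[k.+1%:R]natr1 mulrDl mul1r in k2.
    by apply/andP; split; lra.
  have Cy : C (Ordinal zM) y by rewrite /C /= in_itv/=; lra.
  rewrite /b (bigD1 (Ordinal zM))//=.
  apply: (@le_trans _ _ ((h (Ordinal zM))%:E * (\1_(C (Ordinal zM)) y)%:E)).
    rewrite indicE mem_set// mule1 lee_fin.
    have := hX (Ordinal zM) (y - x (Ordinal zM))%R.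
    by rewrite -/(x _) addrCA subrr addr0; apply; rewrite ger0_norm; lra.
  by rewrite leeDl// sume_ge0// => j _; rewrite mule_ge0// lee_fin.
rewrite ge0_integralD//; last by move=> y _; rewrite mule_ge0// lee_fin.
rewrite ge0_integralZl_EFin//; last by apply: mind; exact: measurableC.
rewrite integral_indic//; last exact: measurableC.
rewrite [X in A%:E * X](_ : _ = 0) ?mule0 ?adde0; last first.
  rewrite setIT; transitivity (lebesgue_measure (set0 : set R)); last exact: measure0.
  by congr lebesgue_measure; exact: setICl.
rewrite ge0_integral_sum//; last by move=> j y _; rewrite mule_ge0// lee_fin.
rewrite mulr_suml -sumEFin; apply: lee_sum => j _.
rewrite ge0_integralZl_EFin//; last exact: mind.
have muC : mu (C j) <= (M%:R^-1)%:E.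
  apply: (@le_trans _ _ (lebesgue_measure (C j))).
    apply: (@le_measure _ _ _ lebesgue_measure).
    - by rewrite inE; apply: measurableI; [exact: mC|exact: mI].
    - by rewrite inE; exact: mC.
    - exact: subIsetl.
  by rewrite lebesgue_measure_itv/= lte_fin ltrDl invr_gt0 M0' -EFinD addrAC subrr add0r.
rewrite integral_indic; [|exact: measurableT|exact: mC].
by rewrite setIT EFinM lee_wpmul2l ?lee_fin.
Qed.

End truncated_mean.

(** * The lower bound in both regimes *)

Local Open Scope ereal_scope.

Lemma measurable_expeR (R : realType) : measurable_fun setT (@expeR R).
Proof.
rewrite (_ : @expeR R = fun x => if x == +oo then +oo else
    if x == -oo then 0 else (expR (fine x))%:E); last first.
  by apply/funext; case.
apply: measurable_fun_ifT => //=; first exact: measurable_fun_eqe.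
apply: measurable_fun_ifT => //=; first exact: measurable_fun_eqe.
by apply/measurable_EFinP; exact: measurableT_comp.
Qed.

(** A monic polynomial that is small with respect to [expeR H] makes the
    distance small. *)
Lemma lne_poly_dist_le (R : realType) (H : circle R -> \bar R)
    (rho : {finite_measure set (circle R) -> \bar R}) (n : nat)
    (q : 'I_n -> R[i]) (a S : R) (E : circle R -> R) :
  measurable_fun setT H -> (forall t, (E t)%:E <= H t) -> (0 <= a)%R ->
  (forall u, Normc.normc (\sum_(k < n) q k * val u ^+ k + val u ^+ n)%R ^+ 2 <=
    a * expR (E u) * expR (- S))%R ->
  a%:E * \int[rho]_t expeR (H t) <= (expR (S / 2))%:E ->
  lne (poly_dist rho n) <= (- (S / 4))%:E.
Proof.
move=> mH EH a0 qE aW.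
have mexpH : measurable_fun setT (fun t => expeR (H t)).
  by apply: measurableT_comp => //; exact: measurable_expeR.
have i1 : \int[rho]_t (Normc.normc (\sum_(k < n) q k * val t ^+ k + val t ^+ n)%R ^+ 2)%:E
    <= (expR (- (S / 2)))%:E.
  apply: (@le_trans _ _ (\int[rho]_t ((a * expR (- S))%:E * expeR (H t)))).
    apply: ge0_le_integral => //.
    - by move=> t _; rewrite lee_fin exprn_ge0// cabs_ge0.
    - by apply/measurable_EFinP; exact: measurable_monic_sqr.
    - exact: measurable_funeM.
    move=> t _; apply: (@le_trans _ _ ((a * expR (- S))%:E * expeR (E t)%:E)).
      by rewrite -EFinM lee_fin mulrAC.
    by rewrite lee_wpmul2l ?lee_fin ?mulr_ge0 ?expR_ge0// lee_expeR.
  rewrite ge0_integralZl_EFin ?mulr_ge0 ?expR_ge0//; last first.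
    by move=> t _; exact: expeR_ge0.
  rewrite mulrC EFinM -muleA.
  apply: le_trans (lee_wpmul2l _ aW) _; first by rewrite lee_fin expR_ge0.
  by rewrite -EFinM lee_fin -expRD ler_expR; lra.
have p0 : 0 <= poly_dist rho n.
  by apply/ereal_infP => _ [r _ <-]; exact: poweR_ge0.
have : poly_dist rho n <= (expR (- (S / 4)))%:E.
  apply: (@le_trans _ _ ((\int[rho]_t (Normc.normc
     (\sum_(k < n) q k * val t ^+ k + val t ^+ n)%R ^+ 2)%:E) `^ 2^-1)).
    by apply: ereal_inf_lbound; exists q.
  have -> : (expR (- (S / 4)))%:E = (expR (- (S / 2)))%:E `^ 2^-1.
    rewrite poweR_EFin; congr _%:E; rewrite /powR gt_eqF ?expR_gt0// expRK.
    by congr expR; field.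
  apply: gt0_ler_poweR; rewrite ?invr_ge0// ?in_itv/= ?leey ?andbT ?lee_fin ?expR_ge0//.
  by apply: integral_ge0 => t _; rewrite lee_fin exprn_ge0// cabs_ge0.
rewrite -[(- (S / 4))%:E]expeRK lee_lne// in_itv/= ?p0 leey//.
by rewrite lee_fin expR_ge0.
Qed.

Section main_bound.
Local Open Scope ereal_scope.
Context (R : realType) (phi : R -> \bar R)
    (phi_continuous : {within `[0%R, (2^-1)%R], continuous phi})
    (phi_decreasing : forall x y : R,
       (0 <= x)%R -> (x < y)%R -> (y <= 2^-1)%R -> phi y < phi x)
    (phi_gt0 : forall x : R, (0 <= x <= 2^-1)%R -> 0 < phi x)
    (phi0 : phi 0%R = +oo)
    (phi_finite : forall x : R, (0 < x <= 2^-1)%R -> phi x < +oo)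
    (phi_regular : regular phi)
    (H : circle R -> \bar R)
    (H_measurable : measurable_fun setT H)
    (H_ge0 : forall t, 0 <= H t)
    (H_int : \int[circle_measure R]_t H t = +oo)
    (phi_le_H : phi (2^-1)%R <= ereal_inf (range H))
    (H_subordinated : subordinated H phi)
    (rho : {finite_measure set (circle R) -> \bar R})
    (rho_int : \int[rho]_t expeR (H t) < +oo).
Local Notation f x := (fine (phi x)).
Local Notation bound c n A :=
  (c%:E * \int[lebesgue_measure]_(a in `[0%R, A]) distr_fun H a
          <= `| lne (poly_dist rho n) |).

(** The common core of both regimes. [s] is the width of the annulus outside
    the unit disk which is used, and [K] bounds [s * A] in terms of [x * phi x]
    at the heights below [A]. *)
Lemma bound_of_scale (K : R) : (0 <= K)%R ->
  exists c eps A0 : R, [/\ (0 < c)%R, (0 < eps <= 4^-1)%R &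
    forall (s A : R) (n : nat), (0 < A)%R -> (A0 <= A)%R -> (0 < s <= 1)%R ->
    (forall x, 0 < x <= 2^-1 -> f x <= A -> s * A <= K * (x * f x))%R ->
    (2 * eps * A + ln s^-1 <= n%:R * (s / 2))%R -> bound c n A].
Proof.
move=> K0.
have [D D1 doubling] := profile_doubling phi_gt0 phi_finite phi_regular.
have DK : (4 <= 4 * D + 68 * K)%R by lra.
have DK0 : (0 < 4 * D + 68 * K)%R by lra.
(* This value makes the [eps]-averages of the truncation at most half of it. *)
pose eps : R := (4 * D + 68 * K)^-1%R.
have eps0 : (0 < eps)%R by rewrite invr_gt0.
have epsDK : (eps * (4 * D + 68 * K) <= 1)%R by rewrite mulVf// gt_eqF.
pose W := fine (\int[rho]_t expeR (H t)).
have WE : \int[rho]_t expeR (H t) = W%:E.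
  by rewrite fineK// ge0_fin_numE// integral_ge0// => t _; exact: expeR_ge0.
have W0 : (0 <= W)%R.
  by rewrite -lee_fin -WE integral_ge0// => t _; exact: expeR_ge0.
pose a : R := (4 * expR 1)%R.
have a0 : (0 <= a)%R by rewrite mulr_ge0 ?expR_ge0.
(* From [A0] on, the factor [exp (- eps * S)] absorbs the constant [a * W]
   and a square root of it is left. *)
have [A0 A00 hA0] := mean_truncation_unbounded H_measurable H_ge0
  (2 * D * (a * W) / eps)%R H_int.
exists (eps / (4 * D))%R, eps, A0; split.
- by rewrite divr_gt0//; lra.
- by rewrite eps0/= /eps lef_pV2// posrE.
move=> s A n A_gt0 A0A s01 hK ns; have A_ge0 := ltW A_gt0.
have [M [M0 mesh [q qE]]] := subordinated_polynomial phi_continuous phi_decreasing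
  phi_gt0 phi_finite phi_regular H_ge0 phi_le_H H_subordinated D1 doubling
  A_gt0 s01 K0 eps0 epsDK hK ns.
set S := ((\sum_j _) / _)%R in qE.
have M0' : (0 < M%:R :> R)%R by rewrite ltr0n.
have meanS : \int[circle_measure R]_t (truncation H A t)%:E <= (D * S)%:E.
  have tr0 t := truncation_ge0 H_ge0 t A_ge0.
  have := @mean_le_mesh R M (truncation H A) A
    (fun j => D * truncation H A (cexp2pi (j%:R / M%:R - 2^-1)))%R
    (measurable_truncation H_measurable A) _ M0 _ mesh.
  rewrite -mulr_sumr -mulrA; apply => [t|j].
    by rewrite tr0 truncation_le.
  by rewrite mulr_ge0//; lra.
have aWS : (2 * D * (a * W) / eps <= D * S)%R.
  by rewrite -lee_fin; exact: le_trans (hA0 A A0A) meanS.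
have D0 : (0 < D)%R by lra.
have aWS' : (a * W <= eps * S / 2)%R.
  move: aWS; rewrite ler_pdivrMr// [(D * S * eps)%R]mulrAC.
  have -> : (2 * D * (a * W) = D * (2 * (a * W)))%R by ring.
  have -> : (D * eps * S = D * (eps * S))%R by ring.
  by rewrite ler_pM2l// ler_pdivlMr// mulrC.
have S0 : (0 <= eps * S)%R.
  by have := mulr_ge0 a0 W0; lra.
have := lne_poly_dist_le (rho := rho) H_measurable
  (fun t => truncation_le_H H_ge0 t A_ge0) a0 qE.
have aWe : (a * W <= expR (eps * S / 2))%R.
  by apply: le_trans aWS' _; have := expR_ge1Dx (eps * S / 2)%R; lra.
rewrite WE -EFinM lee_fin => /(_ aWe) hl.
apply: (@le_trans _ _ (- lne (poly_dist rho n))); last first.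
  by rewrite -abseN lee_abs.
rewrite leeNr; apply: le_trans hl _; rewrite leeNr -EFinN opprK.
apply: (@le_trans _ _ ((eps / (4 * D))%:E * (D * S)%:E)).
  rewrite lee_wpmul2l ?lee_fin ?divr_ge0 ?(ltW eps0) ?mulr_ge0 ?(ltW D0)//.
  exact: le_trans (int_distr_fun_le H_measurable H_ge0 A_ge0) meanS.
rewrite -EFinM lee_fin le_eqVlt; apply/orP; left; apply/eqP; field.
by rewrite gt_eqF.
Qed.

Lemma bound_reg2 : reg2 phi -> exists (c : R) (n0 : nat), (0 < c)%R /\
  forall n : nat, (n0 <= n)%N -> bound c n (Num.sqrt n%:R).
Proof.
move=> [C2 [c2 [_ c20 hc]]].
(* With [s = 6 / A] and [n = A ^ 2], one has [s * A = 6 <= (6 / c2) * x * phi x],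
   and half of [n * s] is [3 * A]. *)
have k0 : (0 <= 6 / c2)%R by rewrite divr_ge0// ltW.
have [c [eps [A0 [c0 /andP[eps0 eps4] hb]]]] := bound_of_scale k0.
exists c, (maxn 36 (Num.bound (A0 ^+ 2))); split => // n.
rewrite geq_max => /andP[n36 nA].
have n36' : (6 <= Num.sqrt n%:R :> R)%R.
  rewrite -(@ler_pXn2r _ 2) ?nnegrE ?sqrtr_ge0// sqr_sqrtr//.
  by rewrite -natrX ler_nat.
have nA0 : (A0 <= Num.sqrt n%:R)%R.
  have [A00|A00] := leP A0 0%R; first by apply: le_trans A00 _; exact: sqrtr_ge0.
  rewrite -(@ler_pXn2r _ 2) ?nnegrE ?sqrtr_ge0 ?(ltW A00)// sqr_sqrtr//.
  apply: le_trans (ltW (archi_boundP (sqr_ge0 A0))) _.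
  by rewrite ler_nat.
have nE : (n%:R = Num.sqrt n%:R * Num.sqrt n%:R :> R)%R.
  by rewrite -expr2 sqr_sqrtr.
move: nE n36' nA0; set A := Num.sqrt n%:R => nE A6 nA0.
have A_gt0 : (0 < A)%R by lra.
apply: (hb (6 / A)%R) => //.
- by rewrite divr_gt0//= ler_pdivrMr// mul1r.
- move=> x x02 _; rewrite divfK ?gt_eqF//.
  have [_] := hc x x02; rewrite (profile_fineE phi_gt0 phi_finite x02) lee_fin.
  have /andP[x0 _] := x02.
  rewrite ler_pdivrMr// mulrC => h.
  by rewrite mulrAC ler_pdivlMr// ler_pM2l.
- have -> : (n%:R * (6 / A / 2) = 3 * A)%R by rewrite nE; field; rewrite gt_eqF.
  rewrite invf_div.
  have : (ln (A / 6) <= A / 6)%R.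
    by apply/ltW/ln_sublinear; rewrite divr_gt0.
  nra.
Qed.

Lemma bound_reg1 : reg1 phi -> exists (c : R) (n0 : nat), (0 < c)%R /\
  forall n : nat, (n0 <= n)%N ->
    (exists! A : R, solves_level_eq phi n A) /\
    (forall A : R, solves_level_eq phi n A -> bound c n A).
Proof.
move=> [hmon [c1 c10 hlog]].
(* With [s = k * x] and [n * x = A], half of [n * s] is [2 * A + A / c1]: the
   first term absorbs [2 * eps * A], the second one [ln (1 / x) <= A / c1]. *)
pose k : R := (4 + 2 / c1)%R.
have c1i : (0 < c1^-1)%R by rewrite invr_gt0.
have k4 : (4 <= k)%R by rewrite /k; lra.
have k0 : (0 <= k)%R by lra.
have [c [eps [A0 [c0 /andP[eps0 eps4] hb]]]] := bound_of_scale k0.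
have [d' d'2 fd'] := profile_unbounded phi_gt0 phi_finite phi_regular A0.
pose d := Num.min d' k^-1%R.
have d0 : (0 < d)%R by rewrite lt_min (andP d'2).1 invr_gt0; lra.
have dd' : (d <= d')%R by rewrite ge_min lexx.
have d2 : (0 < d <= 2^-1)%R by rewrite d0 (le_trans dd')// (andP d'2).2.
have fd : (A0 <= f d)%R.
  apply: le_trans fd' _; apply: fine_profile_nonincreasing => //.
  by case/andP: d'2.
exists c, (maxn 1 (maxn (Num.bound (f d / d)) (Num.bound (2 * f 2^-1)%R))).
split=> // n; rewrite !geq_max => /and3P[n1 nd n2].
have fd0 := fine_profile_gt0 phi_gt0 phi_finite d2.
have h2 : (0 < (2^-1 : R) <= 2^-1)%R by rewrite lexx invr_gt0 ltr0n.
have f20 := fine_profile_gt0 phi_gt0 phi_finite h2.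
have n0 : (0 < n%:R :> R)%R by rewrite ltr0n.
have solx A : solves_level_eq phi n A -> exists2 x : R,
    (0 < x <= 2^-1)%R & f x = A /\ (n%:R * x = A)%R.
  move=> [x [/andP[x0 x2] xA nx]]; exists x; last by rewrite xA.
  rewrite x2 andbT lt_neqAle x0 andbT; apply/negP => /eqP x0'.
  by move: xA; rewrite -x0' phi0.
have flt (x y : R) : (0 < x <= 2^-1)%R -> (0 < y <= 2^-1)%R -> (x < y)%R -> (f y < f x)%R.
  move=> x02 y02 xy; rewrite -lte_fin -!(profile_fineE phi_gt0 phi_finite)//.
  by apply: phi_decreasing; rewrite // ?(ltW (andP x02).1)// (andP y02).2.
split.
  have [|x x02 xE] := @profile_meets_line R phi phi_continuous phi_gt0 phi_finite
     phi_regular 0%R n%:R (ltW n0).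
    rewrite add0r ler_pdivlMr// mulrC.
    apply: le_trans (ltW (archi_boundP _)) _; first by rewrite mulr_ge0// ltW.
    by rewrite ler_nat.
  rewrite add0r in xE.
  exists (n%:R * x)%R; split.
    exists x; split => //; case/andP: x02 => x0 ->; rewrite (ltW x0)//.
  move=> B /solx[y y02 [fy ny]].
  have fx : f x = (n%:R * x)%R by rewrite xE.
  have [xy|yx|->//] := ltgtP x y.
    have := flt x y x02 y02 xy.
    by rewrite fx fy -ny ltr_pM2l// ltNge (ltW xy).
  have := flt y x y02 x02 yx.
  by rewrite fx fy -ny ltr_pM2l// ltNge (ltW yx).
move=> A /solx[x x02 [fx nx]].
have /andP[x0 x2] := x02.
(* Otherwise [n * x >= n * d > phi d >= phi x]. *)
have xd : (x < d)%R.
  rewrite ltNge; apply/negP => dx.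
  have h1 : (f x <= f d)%R.
    exact: (fine_profile_nonincreasing phi_decreasing phi_gt0 phi_finite d0 dx x2).
  have h3 : (f d < n%:R * d)%R.
    rewrite -ltr_pdivrMr//; apply: lt_le_trans (archi_boundP _) _.
      by rewrite divr_ge0 ?(ltW fd0) ?(ltW d0).
    by rewrite ler_nat.
  have h4 : (n%:R * d <= n%:R * x)%R by rewrite ler_pM2l.
  by move: h1; rewrite fx -nx leNgt (lt_le_trans h3).
have A_gt0 : (0 < A)%R by rewrite -fx; exact: fine_profile_gt0.
have xk : (k * x <= 1)%R.
  rewrite mulrC -ler_pdivlMr ?mul1r; last by lra.
  by apply: le_trans (ltW xd) _; rewrite ge_min lexx orbT.
apply: (hb (k * x)%R) => //.
- by rewrite -fx (le_trans fd)// ltW// flt.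
- by rewrite xk mulr_gt0//; lra.
- move=> y y02 fyA; rewrite -mulrA ler_wpM2l// -fx.
  have xy : (x <= y)%R.
    by rewrite leNgt; apply/negP => /(flt y x y02 x02); rewrite fx ltNge fyA.
  have := hmon x y x0 xy (andP y02).2.
  by rewrite (profile_fineE phi_gt0 phi_finite x02)
      (profile_fineE phi_gt0 phi_finite y02) -!EFinM lee_fin.
- have -> : (n%:R * (k * x / 2) = k / 2 * A)%R by rewrite -nx; field.
  have l1 : (ln (k * x)^-1 <= ln x^-1)%R.
    rewrite ler_ln ?posrE ?invr_gt0 ?mulr_gt0//; try lra.
    rewrite lef_pV2 ?posrE ?mulr_gt0//; try lra.
    by rewrite ler_peMl//; lra.
  have l2 : (ln x^-1 <= A / c1)%R.
    have := hlog x x02; rewrite (profile_fineE phi_gt0 phi_finite x02) lee_fin fx.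
    by rewrite ler_pdivlMr// mulrC.
  have -> : (k / 2 * A = 2 * A + A / c1)%R by rewrite /k; field; rewrite gt_eqF.
  have : (2 * eps * A <= 2 * A)%R by rewrite ler_pM2r//; lra.
  lra.
Qed.

End main_bound.

Theorem theorem4 (R : realType) (phi : R -> \bar R)
    (phi_continuous : {within `[0%R, (2^-1)%R], continuous phi})
    (phi_decreasing : forall x y : R,
       (0 <= x)%R -> (x < y)%R -> (y <= 2^-1)%R -> phi y < phi x)
    (phi_gt0 : forall x : R, (0 <= x <= 2^-1)%R -> 0 < phi x)
    (phi0 : phi 0%R = +oo)
    (phi_finite : forall x : R, (0 < x <= 2^-1)%R -> phi x < +oo)
    (phi_regular : regular phi)
    (H : circle R -> \bar R)
    (H_measurable : measurable_fun setT H)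
    (H_ge0 : forall t, 0 <= H t)
    (H_int : \int[circle_measure R]_t H t = +oo)
    (phi_le_H : phi (2^-1)%R <= ereal_inf (range H))
    (H_subordinated : subordinated H phi)
    (rho : {finite_measure set (circle R) -> \bar R})
    (rho_int : \int[rho]_t expeR (H t) < +oo) :
  exists (c : R) (n0 : nat), (0 < c)%R /\
    forall n : nat, (n0 <= n)%N ->
      let bound (A : R) :=
        c%:E * \int[lebesgue_measure]_(a in `[0%R, A]) distr_fun H a
          <= `| lne (poly_dist rho n) | in
      (reg1 phi ->
         (exists! A : R, solves_level_eq phi n A) /\
         (forall A : R, solves_level_eq phi n A -> bound A)) /\
      (reg2 phi -> bound (Num.sqrt n%:R)).
Proof.
have main1 : exists (c : R) (n0 : nat), (0 < c)%R /\ forall n, (n0 <= n)%N ->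
    reg1 phi -> (exists! A : R, solves_level_eq phi n A) /\
    (forall A : R, solves_level_eq phi n A ->
      c%:E * \int[lebesgue_measure]_(a in `[0%R, A]) distr_fun H a
        <= `| lne (poly_dist rho n) |).
  have [r1|nr1] := pselect (reg1 phi).
    have [c [n0 [c0 hc]]] := bound_reg1 phi_continuous phi_decreasing phi_gt0
      phi0 phi_finite phi_regular H_measurable H_ge0 H_int phi_le_H
      H_subordinated rho_int r1.
    by exists c, n0; split => // n nn0 _; exact: hc.
  by exists 1%R, 0%N; split.
have main2 : exists (c : R) (n0 : nat), (0 < c)%R /\ forall n, (n0 <= n)%N ->
    reg2 phi ->
      c%:E * \int[lebesgue_measure]_(a in `[0%R, Num.sqrt n%:R]) distr_fun H a
        <= `| lne (poly_dist rho n) |.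
  have [r2|nr2] := pselect (reg2 phi).
    have [c [n0 [c0 hc]]] := bound_reg2 phi_continuous phi_decreasing phi_gt0
      phi_finite phi_regular H_measurable H_ge0 H_int phi_le_H
      H_subordinated rho_int r2.
    by exists c, n0; split => // n nn0 _; exact: hc.
  by exists 1%R, 0%N; split.
have [c1 [n1 [c10 h1]]] := main1; have [c2 [n2 [c20 h2]]] := main2.
have mono (A c : R) : (Num.min c1 c2 <= c)%R ->
    (Num.min c1 c2)%:E * \int[lebesgue_measure]_(a in `[0%R, A]) distr_fun H a
    <= c%:E * \int[lebesgue_measure]_(a in `[0%R, A]) distr_fun H a.
  move=> cc; rewrite lee_wpmul2r ?lee_fin//.
  by apply: integral_ge0 => a _; exact: measure_ge0.
exists (Num.min c1 c2), (maxn n1 n2); split; first by rewrite lt_min c10.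
move=> n; rewrite geq_max => /andP[nn1 nn2] bound; split=> [r1|r2].
  have [ex hA] := h1 n nn1 r1; split=> // A solA.
  apply: le_trans (hA A solA); apply: mono; by rewrite ge_min lexx.
by apply: le_trans (h2 n nn2 r2); apply: mono; rewrite ge_min lexx orbT.
Qed.
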